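(* Let $\mathcal{B}$ be a unital $C^*$-algebra. Suppose that $\mu(t),\nu(t):[0,1]\to\Sigma_0$ are differentiable paths. Then for $b\in H^+(\mathcal{B})$, $$\partial G_{\mu(t)\uplus\nu(t)}(b)=\big(F_{\mu(t)}(b)+F_{\nu(t)}(b)-b\big)^{-1}\Big(F_{\mu(t)}(b)\,\partial G_{\mu(t)}(b)\,F_{\mu(t)}(b)+F_{\nu(t)}(b)\,\partial G_{\nu(t)}(b)\,F_{\nu(t)}(b)\Big)\big(F_{\mu(t)}(b)+F_{\nu(t)}(b)-b\big)^{-1}$$ and $$\partial G_{\mu(t)\triangleright\nu(t)}(b)=G'_{\mu(t)}(F_{\nu(t)}(b))\big(-F_{\nu(t)}(b)\,\partial G_{\nu(t)}(b)\,F_{\nu(t)}(b)\big)+\partial G_{\mu(t)}(F_{\nu(t)}(b)).$$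
   Context: $\mathcal{B}\langle X\rangle$ is the $*$-algebra of non-commutative polynomials over $\mathcal{B}$ such that $\mathcal{B}$ and $X=X^*$ are algebraically free. A $\mathcal{B}$-valued distribution is a linear, $\mathcal{B}$-bimodule, completely positive map $\mu:\mathcal{B}\langle X\rangle\to\mathcal{B}$ with $\mu(1)=1$. It is exponentially bounded if there is $M>0$ with $\|\mu(Xb_1Xb_2\cdots b_nX)\|\le M^{n+1}\|b_1\|\cdots\|b_n\|$ for all $b_1,\dots,b_n\in\mathcal{B}$; $\Sigma_0$ is the space of exponentially bounded $\mathcal{B}$-valued distributions. A $C^*$-operator-valued probability space $(\mathcal{A},\mathcal{B},E)$ is a unital $C^*$-algebra $\mathcal{A}$ containing $\mathcal{B}$ as a unital $C^*$-subalgebra with a completely positive linear $E:\mathcal{A}\to\mathcal{B}$ satisfying $E(b)=b$, $E(bab')=bE(a)b'$. Every $\mu\in\Sigma_0$ is the distribution $\mu_x$ of some $x=x^*$ in such a space, i.e. $\mu(P(X))=E(P(x))$. With $H^+(M_n(\mathcal{B}))$ the set of elements whose imaginary part $\frac{1}{2i}(b-b^* )$ is positive and invertible, $G_\mu^{(n)}(b)=(E\otimes 1_n)[(b-x\otimes 1_n)^{-1}]$ for $b\in H^+(M_n(\mathcal{B}))$ depends only on $\mu$; write $G_\mu=G_\mu^{(1)}$ and $F_\mu(b)=G_\mu(b)^{-1}$. Convolutions: subalgebras $(\mathcal{A}_i)_{i\in I}$ of $\mathcal{A}$ containing $\mathcal{B}$ are Boolean independent over $\mathcal{B}$ if $E(a_1\cdots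 a_n)=E(a_1)\cdots E(a_n)$ whenever $a_j\in\mathcal{A}_{i_j}$ with $i_1\ne\cdots\ne i_n$ (consecutive indices distinct); for linearly ordered $I$ they are monotone independent over $\mathcal{B}$ if $E(a_1\cdots a_n)=E(a_1\cdots a_{j-1}E(a_j)a_{j+1}\cdots a_n)$ whenever $a_k\in\mathcal{A}_{i_k}$ and $i_{j-1}<i_j>i_{j+1}$ (one inequality eliminated if $j=1$ or $j=n$). Elements $x,y$ are Boolean (resp. monotone) independent over $\mathcal{B}$ if the unital algebras they generate (as subalgebras containing $\mathcal{B}$) are, the index of $x$ being smaller than that of $y$ in the monotone case. If $x,y$ are Boolean (resp. monotone) independent, the distribution of $x+y$ depends only on $\mu_x,\mu_y$ and is called the Boolean (resp. monotone) additive convolution, denoted $\mu_x\uplus\mu_y$ (resp. $\mu_x\triangleright\mu_y$). A path $\mu(t):[0,1]\to\Sigma_0$ is differentiable if for each $n\in\mathbb{N}$ and $t\in[0,1]$ there is a map $Y_t^{(n)}:H^+(M_n(\mathcal{B}))\to M_n(\mathcal{B})$ such that for all $b\in H^+(\mathcal{B})$, $$\Big\|\tfrac1h\big(G^{(n)}_{\mu(t+h)}(b\otimes1_n)-G^{(n)}_{\mu(t)}(b\otimes1_n)\big)-Y_t^{(n)}(b\otimes1_n)\Big\|\to0\quad\text{as }h\to0.$$ For a path, $\partial G_{\mu(t)}(b)=\lim_{h\to0}\frac{G_{\mu(t+h)}(b)-G_{\mu(t)}(b)}{h}$, and $G'_{\mu(t)}(b)(\cdot)=\lim_{h\to0}\frac{G_{\mu(t)}(b+h\,\cdot)-G_{\mu(t)}(b)}{h}$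 is the Fréchet derivative of $G_{\mu(t)}$ at $b$. *)

(* Defs.v *)
From HB Require Import structures.
From mathcomp Require Import all_boot all_order all_algebra.
From mathcomp Require Import generic_quotient complex.
From mathcomp Require Import boolp classical_sets functions reals topology normedtype.

Set Implicit Arguments.
Unset Strict Implicit.
Unset Printing Implicit Defensive.

Import Order.TTheory GRing.Theory Num.Theory numFieldNormedType.Exports.

Local Open Scope classical_set_scope.
Local Open Scope complex_scope.
Local Open Scope ring_scope.
Local Open Scope quotient_scope.

HB.mixin Record PzRing_hasStar A of GRing.PzRing A := {
  star : A -> A;
  starK : involutive star;
  starD : {morph star : a b / a + b};
  starM : forall a b : A, star (a * b) = star b * star a }.

#[short(type="starRingType")]
HB.structure Definition StarRing := {A of GRing.PzRing A & PzRing_hasStar A}.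

(* The norm is a field of this structure, and not the norm of a
   completeNormedModType: Hierarchy Builder refuses the join of a normed
   module with a ring, because of the prior declaration of numDomainType. *)
HB.mixin Record isCstarAlgebra (R : realType) A of GRing.UnitAlgebra R[i] A
    & StarRing A := {
  starZ : forall (z : R[i]) (a : A), star (z *: a) = z^* *: star a;
  cnorm : A -> R;
  cnorm0_eq0 : forall a, cnorm a = 0 -> a = 0;
  cnormD_le : forall a b, cnorm (a + b) <= cnorm a + cnorm b;
  cnormZ : forall (z : R[i]) a, cnorm (z *: a) = Normc.normc z * cnorm a;
  cnormM_le : forall a b, cnorm (a * b) <= cnorm a * cnorm b;
  cnorm_starM : forall a, cnorm (star a * a) = cnorm a ^+ 2;
  cnorm_complete : forall u : nat -> A,
    (forall e : R, 0 < e -> exists N, forall m n, (N <= m)%N -> (N <= n)%N ->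
       cnorm (u m - u n) < e) ->
    exists l, forall e : R, 0 < e -> exists N, forall n, (N <= n)%N ->
       cnorm (u n - l) < e }.

#[short(type="cstarAlgType")]
HB.structure Definition CstarAlgebra (R : realType) :=
  {A of GRing.UnitAlgebra R[i] A & StarRing A & isCstarAlgebra R A}.

Definition selfadjoint (A : starRingType) (a : A) : Prop := star a = a.

Definition positive (A : starRingType) (a : A) : Prop :=
  exists c, a = star c * c.

Section CstarTheory.
Variables (R : realType) (A : cstarAlgType R).

Definition impart (b : A) : A := (2 * 'i : R[i])^-1 *: (b - star b).

Definition upper_half : set A :=
  [set b | positive (impart b) /\ impart b \is a GRing.unit].

Definition norm_cvg (T : Type) (F : set_system T) (f : T -> A) (l : A) : Prop :=
  cnorm (f h - l) @[h --> F] --> (0 : R).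

(* 0 if the limit does not exist *)
Definition norm_lim (T : Type) (F : set_system T) (f : T -> A) : A :=
  xget 0 [set l | norm_cvg F f l].

(* f'(b)(w); the increment h is complex *)
Definition derivative (f : A -> A) (b w : A) : A :=
  norm_lim (0 : R[i]^o)^' (fun h : R[i] => h^-1 *: (f (b + h *: w) - f b)).

End CstarTheory.

Definition mxstar (A : starRingType) m n (M : 'M[A]_(m, n)) : 'M[A]_(n, m) :=
  map_mx (@star A) M^T.

Definition mxpositive (A : starRingType) n (M : 'M[A]_n) : Prop :=
  exists C : 'M[A]_n, M = mxstar C *m C.

Definition is_mxinverse (A : pzRingType) n (M N : 'M[A]_n) : Prop :=
  M *m N = 1%:M /\ N *m M = 1%:M.

(* The norm of M_n(A) as the algebra of the adjointable operators of the
   Hilbert A-module A^n, which is its unique C*-norm. *)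
Definition mxcnorm (R : realType) (A : cstarAlgType R) n (M : 'M[A]_n) : R :=
  let colnorm (v : 'cV[A]_n) :=
    Num.sqrt (cnorm ((mxstar v *m v) ord0 ord0)) in
  sup [set colnorm (M *m v) | v in [set v | colnorm v <= 1]].

Definition completely_positive (A B : starRingType) (f : A -> B) : Prop :=
  forall n (P : 'M[A]_n), mxpositive (map_mx f (mxstar P *m P)).

Section NCPoly.
Variables (R : realType) (B : cstarAlgType R).

Inductive ncexpr : Type :=
| NCconst of B
| NCvar
| NCadd of ncexpr & ncexpr
| NCmul of ncexpr & ncexpr.

(* The least congruence whose quotient is a complex algebra that contains B as
   a subalgebra; the scalars are those of B, which commute with the variable. *)
Inductive nceq : ncexpr -> ncexpr -> Prop :=
| nceq_refl p : nceq p p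
| nceq_sym p q : nceq p q -> nceq q p
| nceq_trans p q r : nceq p q -> nceq q r -> nceq p r
| nceq_add p p' q q' : nceq p p' -> nceq q q' -> nceq (NCadd p q) (NCadd p' q')
| nceq_mul p p' q q' : nceq p p' -> nceq q q' -> nceq (NCmul p q) (NCmul p' q')
| nceq_addA p q r : nceq (NCadd p (NCadd q r)) (NCadd (NCadd p q) r)
| nceq_addC p q : nceq (NCadd p q) (NCadd q p)
| nceq_add0 p : nceq (NCadd (NCconst 0) p) p
| nceq_mulA p q r : nceq (NCmul p (NCmul q r)) (NCmul (NCmul p q) r)
| nceq_mul1 p : nceq (NCmul (NCconst 1) p) p
| nceq_mulr1 p : nceq (NCmul p (NCconst 1)) p
| nceq_mul0 p : nceq (NCmul (NCconst 0) p) (NCconst 0)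
| nceq_mulDl p q r : nceq (NCmul (NCadd p q) r) (NCadd (NCmul p r) (NCmul q r))
| nceq_mulDr p q r : nceq (NCmul p (NCadd q r)) (NCadd (NCmul p q) (NCmul p r))
| nceq_constD b c : nceq (NCconst (b + c)) (NCadd (NCconst b) (NCconst c))
| nceq_constM b c : nceq (NCconst (b * c)) (NCmul (NCconst b) (NCconst c))
| nceq_scalar (z : R[i]) :
    nceq (NCmul (NCconst z%:A) NCvar) (NCmul NCvar (NCconst z%:A)).

HB.instance Definition _ := gen_eqMixin ncexpr.
HB.instance Definition _ := gen_choiceMixin ncexpr.

Definition nceqb : rel ncexpr := fun p q => `[< nceq p q >].

Lemma nceqb_equiv : equiv_class_of nceqb.
Proof.
split.
- by move=> p; apply/asboolP; exact: nceq_refl.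
- by move=> p q; apply/asboolP/asboolP; exact: nceq_sym.
- by move=> q p r /asboolP pq /asboolP qr; apply/asboolP; exact: nceq_trans qr.
Qed.

Canonical nceq_equiv_rel := EquivRelPack nceqb_equiv.

Definition ncpoly : Type := {eq_quot nceq_equiv_rel}.

HB.instance Definition _ := Choice.on ncpoly.
HB.instance Definition _ := EqQuotient.on ncpoly.

Lemma ncpoly_eqP (p q : ncexpr) :
  reflect (nceq p q) (\pi_ncpoly p == \pi_ncpoly q).
Proof. by rewrite eqmodE; exact: asboolP. Qed.

Lemma ncpiP (p q : ncexpr) : nceq p q -> \pi_ncpoly p = \pi_ncpoly q.
Proof. by move/ncpoly_eqP/eqP. Qed.

Lemma nceq_repr (p : ncexpr) : nceq (repr (\pi_ncpoly p)) p.
Proof. by apply/ncpoly_eqP; rewrite reprK. Qed.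

Definition nccst (b : B) : ncpoly := \pi_ncpoly (NCconst b).
Definition ncX : ncpoly := \pi_ncpoly NCvar.
Definition nc_add (p q : ncpoly) : ncpoly := \pi_ncpoly (NCadd (repr p) (repr q)).
Definition nc_mul (p q : ncpoly) : ncpoly := \pi_ncpoly (NCmul (repr p) (repr q)).
Definition nc_opp (p : ncpoly) : ncpoly := nc_mul (nccst (-1)) p.
Definition nc_scale (z : R[i]) (p : ncpoly) : ncpoly := nc_mul (nccst z%:A) p.

Lemma nc_addE p q : nc_add (\pi_ncpoly p) (\pi_ncpoly q) = \pi_ncpoly (NCadd p q).
Proof. by apply: ncpiP; apply: nceq_add; exact: nceq_repr. Qed.

Lemma nc_mulE p q : nc_mul (\pi_ncpoly p) (\pi_ncpoly q) = \pi_ncpoly (NCmul p q).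
Proof. by apply: ncpiP; apply: nceq_mul; exact: nceq_repr. Qed.

Lemma ncpolyW (P : ncpoly -> Prop) : (forall p, P (\pi_ncpoly p)) -> forall p, P p.
Proof. by move=> h p; rewrite -[p]reprK. Qed.

Lemma nc_addA : associative nc_add.
Proof.
elim/ncpolyW=> p; elim/ncpolyW=> q; elim/ncpolyW=> r.
by rewrite !nc_addE; apply: ncpiP; exact: nceq_addA.
Qed.

Lemma nc_addC : commutative nc_add.
Proof.
elim/ncpolyW=> p; elim/ncpolyW=> q.
by rewrite !nc_addE; apply: ncpiP; exact: nceq_addC.
Qed.

Lemma nc_add0 : left_id (nccst 0) nc_add.
Proof. by elim/ncpolyW=> p; rewrite nc_addE; apply: ncpiP; exact: nceq_add0. Qed.

Lemma nc_mulA : associative nc_mul.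
Proof.
elim/ncpolyW=> p; elim/ncpolyW=> q; elim/ncpolyW=> r.
by rewrite !nc_mulE; apply: ncpiP; exact: nceq_mulA.
Qed.

Lemma nc_mul1 : left_id (nccst 1) nc_mul.
Proof. by elim/ncpolyW=> p; rewrite nc_mulE; apply: ncpiP; exact: nceq_mul1. Qed.

Lemma nc_mulr1 : right_id (nccst 1) nc_mul.
Proof. by elim/ncpolyW=> p; rewrite nc_mulE; apply: ncpiP; exact: nceq_mulr1. Qed.

Lemma nc_mul0 : left_zero (nccst 0) nc_mul.
Proof. by elim/ncpolyW=> p; rewrite nc_mulE; apply: ncpiP; exact: nceq_mul0. Qed.

Lemma nc_mulDl : left_distributive nc_mul nc_add.
Proof.
elim/ncpolyW=> p; elim/ncpolyW=> q; elim/ncpolyW=> r.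
by rewrite !(nc_addE, nc_mulE); apply: ncpiP; exact: nceq_mulDl.
Qed.

Lemma nc_mulDr : right_distributive nc_mul nc_add.
Proof.
elim/ncpolyW=> p; elim/ncpolyW=> q; elim/ncpolyW=> r.
by rewrite !(nc_addE, nc_mulE); apply: ncpiP; exact: nceq_mulDr.
Qed.

Lemma nccst_add b c : nccst (b + c) = nc_add (nccst b) (nccst c).
Proof. by rewrite nc_addE; apply: ncpiP; exact: nceq_constD. Qed.

Lemma nccst_mul b c : nccst (b * c) = nc_mul (nccst b) (nccst c).
Proof. by rewrite nc_mulE; apply: ncpiP; exact: nceq_constM. Qed.

Lemma nc_addN : left_inverse (nccst 0) nc_opp nc_add.
Proof.
move=> p; rewrite /nc_opp -{2}[p]nc_mul1 -nc_mulDl -nccst_add addNr.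
exact: nc_mul0.
Qed.

HB.instance Definition _ :=
  GRing.isZmodule.Build ncpoly nc_addA nc_addC nc_add0 nc_addN.

Fixpoint ncexpr_eval (A : algType R[i]) (f : B -> A) (x : A) (p : ncexpr) : A :=
  match p with
  | NCconst b => f b
  | NCvar => x
  | NCadd p q => ncexpr_eval f x p + ncexpr_eval f x q
  | NCmul p q => ncexpr_eval f x p * ncexpr_eval f x q
  end.

Lemma nceq_eval (A : algType R[i]) (f : {lrmorphism B -> A}) (x : A) p q :
  nceq p q -> ncexpr_eval f x p = ncexpr_eval f x q.
Proof.
elim=> //=.
- by move=> ? ? ? _ -> _ ->.
- by move=> ? ? ? ? _ -> _ ->.
- by move=> ? ? ? ? _ -> _ ->.
- by move=> *; rewrite addrA.
- by move=> *; rewrite addrC.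
- by move=> *; rewrite rmorph0 add0r.
- by move=> *; rewrite mulrA.
- by move=> *; rewrite rmorph1 mul1r.
- by move=> *; rewrite rmorph1 mulr1.
- by move=> *; rewrite rmorph0 mul0r.
- by move=> *; rewrite mulrDl.
- by move=> *; rewrite mulrDr.
- by move=> *; rewrite rmorphD.
- by move=> *; rewrite rmorphM.
- by move=> z; rewrite linearZ rmorph1 /= -scalerAl mul1r -scalerAr mulr1.
Qed.

Definition nceval (A : algType R[i]) (f : B -> A) (x : A) (p : ncpoly) : A :=
  ncexpr_eval f x (repr p).

Lemma nceval_pi (A : algType R[i]) (f : {lrmorphism B -> A}) (x : A) p :
  nceval f x (\pi_ncpoly p) = ncexpr_eval f x p.
Proof. by apply: nceq_eval; exact: nceq_repr. Qed.

Lemma nc_1_neq0 : nccst 1 != nccst 0.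
Proof.
apply/eqP=> /(congr1 (nceval (idfun : {lrmorphism B -> B}) 0)).
by rewrite !nceval_pi /=; apply/eqP; exact: oner_neq0.
Qed.

HB.instance Definition _ := GRing.Zmodule_isNzRing.Build ncpoly
  nc_mulA nc_mul1 nc_mulr1 nc_mulDl nc_mulDr nc_1_neq0.

Lemma nccstD b c : nccst (b + c) = nccst b + nccst c.
Proof. exact: nccst_add. Qed.

Lemma nccstM b c : nccst (b * c) = nccst b * nccst c.
Proof. exact: nccst_mul. Qed.

Lemma nc_scalar_comm (z : R[i]) (p : ncpoly) :
  nccst z%:A * p = p * nccst z%:A.
Proof.
elim/ncpolyW: p; elim=> [b||p IHp q IHq|p IHp q IHq].
- by rewrite -[\pi _]/(nccst b) -!nccstM -scalerAl mul1r -scalerAr mulr1.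
- rewrite /nccst /GRing.mul /= !nc_mulE; apply: ncpiP; exact: nceq_scalar.
- by rewrite -nc_addE -[nc_add _ _]/(\pi_ncpoly p + \pi_ncpoly q) mulrDr mulrDl
     IHp IHq.
- rewrite -nc_mulE -[nc_mul _ _]/(\pi_ncpoly p * \pi_ncpoly q).
  by rewrite mulrA IHp -mulrA IHq mulrA.
Qed.

Lemma nc_scaleA a b p : nc_scale a (nc_scale b p) = nc_scale (a * b) p.
Proof.
by rewrite /nc_scale nc_mulA -nccst_mul -scalerAl mul1r scalerA.
Qed.

Lemma nc_scale1 : left_id 1 nc_scale.
Proof. by move=> p; rewrite /nc_scale scale1r nc_mul1. Qed.

Lemma nc_scaleDr : right_distributive nc_scale +%R.
Proof. by move=> z p q; exact: nc_mulDr. Qed.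

Lemma nc_scaleDl p : {morph nc_scale^~ p : a b / a + b}.
Proof. by move=> a b; rewrite /nc_scale scalerDl nccst_add; exact: nc_mulDl. Qed.

HB.instance Definition _ := GRing.Zmodule_isLmodule.Build R[i] ncpoly
  nc_scaleA nc_scale1 nc_scaleDr nc_scaleDl.

Lemma nc_scaleAl (z : R[i]) (p q : ncpoly) : z *: (p * q) = (z *: p) * q.
Proof. exact: nc_mulA. Qed.

HB.instance Definition _ := GRing.Lmodule_isLalgebra.Build R[i] ncpoly
  nc_scaleAl.

Lemma nc_scaleAr (z : R[i]) (p q : ncpoly) : z *: (p * q) = p * (z *: q).
Proof.
rewrite -[z *: (p * q)]/(nccst z%:A * (p * q)) -[z *: q]/(nccst z%:A * q).
by rewrite mulrA nc_scalar_comm -mulrA.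
Qed.

HB.instance Definition _ := GRing.Lalgebra_isAlgebra.Build R[i] ncpoly
  nc_scaleAr.

Fixpoint ncexpr_star (p : ncexpr) : ncexpr :=
  match p with
  | NCconst b => NCconst (star b)
  | NCvar => NCvar
  | NCadd p q => NCadd (ncexpr_star p) (ncexpr_star q)
  | NCmul p q => NCmul (ncexpr_star q) (ncexpr_star p)
  end.

Lemma star0 : star (0 : B) = 0.
Proof. by apply: (addrI (star 0)); rewrite -starD !addr0. Qed.

Lemma star1 : star (1 : B) = 1.
Proof. by rewrite -[LHS]mulr1 -[1 in X in _ * X]starK -starM mulr1 starK. Qed.

Lemma nceq_star p q : nceq p q -> nceq (ncexpr_star p) (ncexpr_star q).
Proof.
elim=> //=; rewrite ?star0 ?star1.
- by move=> *; exact: nceq_refl.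
- by move=> *; exact: nceq_sym.
- by move=> p' q' r _ pq _ qr; exact: nceq_trans qr.
- by move=> *; exact: nceq_add.
- by move=> *; exact: nceq_mul.
- by move=> *; exact: nceq_addA.
- by move=> *; exact: nceq_addC.
- by move=> *; exact: nceq_add0.
- by move=> *; apply: nceq_sym; exact: nceq_mulA.
- by move=> *; exact: nceq_mulr1.
- by move=> *; exact: nceq_mul1.
- move=> p'; apply/ncpoly_eqP; rewrite -nc_mulE; apply/eqP.
  by rewrite -[nc_mul _ _]/(\pi_ncpoly (ncexpr_star p') * 0) mulr0.
- by move=> *; exact: nceq_mulDr.
- by move=> *; exact: nceq_mulDl.
- by move=> *; rewrite starD; exact: nceq_constD.
- by move=> *; rewrite starM; exact: nceq_constM.
- by move=> z; rewrite starZ star1; apply: nceq_sym; exact: nceq_scalar.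
Qed.

Definition nc_star (p : ncpoly) : ncpoly := \pi_ncpoly (ncexpr_star (repr p)).

Lemma nc_starE p : nc_star (\pi_ncpoly p) = \pi_ncpoly (ncexpr_star p).
Proof. by apply: ncpiP; apply: nceq_star; exact: nceq_repr. Qed.

Lemma nc_starK : involutive nc_star.
Proof.
elim/ncpolyW=> p; rewrite !nc_starE; congr (\pi _).
by elim: p => //= [b|p -> q ->|p -> q ->] //; rewrite starK.
Qed.

Lemma nc_starD : {morph nc_star : p q / p + q}.
Proof.
elim/ncpolyW=> p; elim/ncpolyW=> q.
by rewrite /GRing.add /= !(nc_addE, nc_starE).
Qed.

Lemma nc_starM (p q : ncpoly) : nc_star (p * q) = nc_star q * nc_star p.
Proof.
elim/ncpolyW: p => p; elim/ncpolyW: q => q.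
by rewrite /GRing.mul /= !(nc_mulE, nc_starE).
Qed.

HB.instance Definition _ := PzRing_hasStar.Build ncpoly
  nc_starK nc_starD nc_starM.

Section Evaluation.
Variables (A : algType R[i]) (f : {lrmorphism B -> A}) (x : A).

Lemma nceval_cst b : nceval f x (nccst b) = f b.
Proof. by rewrite nceval_pi. Qed.

Lemma nceval_X : nceval f x ncX = x.
Proof. by rewrite nceval_pi. Qed.

Lemma ncevalD : {morph nceval f x : p q / p + q}.
Proof.
elim/ncpolyW=> p; elim/ncpolyW=> q.
by rewrite {1}/GRing.add /= nc_addE !nceval_pi.
Qed.

Lemma ncevalM : {morph nceval f x : p q / p * q}.
Proof.
elim/ncpolyW=> p; elim/ncpolyW=> q.
by rewrite {1}/GRing.mul /= nc_mulE !nceval_pi.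
Qed.

End Evaluation.

(* X b_1 X b_2 ... b_n X, for s = [:: b_1; ...; b_n] *)
Definition ncword (s : seq B) : ncpoly :=
  ncX * \prod_(b <- s) (nccst b * ncX).

(* The space Sigma_0 of the exponentially bounded B-valued distributions *)
Record sigma0 : Type := Sigma0 {
  distr :> {linear ncpoly -> B};
  distr_bimodule : forall b p c, distr (nccst b * p * nccst c) = b * distr p * c;
  distr_cp : completely_positive distr;
  distr1 : distr 1 = 1;
  distr_bounded : exists M : R, 0 < M /\ forall s : seq B,
    cnorm (distr (ncword s)) <= M ^+ (size s).+1 * \prod_(b <- s) cnorm b }.

(* ovps_inj is the inclusion of B in the larger algebra; it is injective by
   ovps_Einj, hence isometric. *)
Record ovps : Type := Ovps {
  ovps_alg :> cstarAlgType R;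
  ovps_inj : {lrmorphism B -> ovps_alg};
  ovps_inj_star : forall b, ovps_inj (star b) = star (ovps_inj b);
  ovps_E : {linear ovps_alg -> B};
  ovps_cp : completely_positive ovps_E;
  ovps_Einj : forall b, ovps_E (ovps_inj b) = b;
  ovps_bimodule : forall b a c,
    ovps_E (ovps_inj b * a * ovps_inj c) = b * ovps_E a * c }.

Definition has_law (P : ovps) (x : P) (mu : sigma0) : Prop :=
  forall p, mu p = ovps_E P (nceval (ovps_inj P) x p).

(* For b in the upper half-plane, the value does not depend on the realization
   of mu. *)
Definition cauchyn n (mu : sigma0) (b : 'M[B]_n) : 'M[B]_n :=
  xget 0 [set g | exists (P : ovps) (x : P) (r : 'M[P]_n),
    [/\ selfadjoint x, has_law x mu,
        is_mxinverse (map_mx (ovps_inj P) b - x%:M) r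
      & g = map_mx (ovps_E P) r]].

(* G_mu, where M_1(B) is identified with B, and its reciprocal F_mu *)
Definition cauchy (mu : sigma0) (b : B) : B := cauchyn mu (b%:M : 'M_1) ord0 ord0.
Definition rcauchy (mu : sigma0) (b : B) : B := (cauchy mu b)^-1.

(* The words are a_0 ... a_(n-1), with a_k in the algebra of index i_k. *)
Definition boolean_independent (P : ovps) (I : eqType) (S : I -> set P) : Prop :=
  forall (n : nat) (i : nat -> I) (a : nat -> P),
  (forall k, (k < n)%N -> S (i k) (a k)) ->
  (forall k, (k.+1 < n)%N -> i k != i k.+1) ->
  ovps_E P (\prod_(0 <= k < n) a k) = \prod_(0 <= k < n) ovps_E P (a k).

Definition monotone_independent (P : ovps) (d : Order.disp_t) (I : orderType d)
    (S : I -> set P) : Prop :=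
  forall (n : nat) (i : nat -> I) (a : nat -> P) (j : nat),
  (forall k, (k < n)%N -> S (i k) (a k)) ->
  (j < n)%N ->
  ((0 < j)%N -> (i j.-1 < i j)%O) ->
  ((j.+1 < n)%N -> (i j.+1 < i j)%O) ->
  ovps_E P (\prod_(0 <= k < n) a k) =
  ovps_E P (\prod_(0 <= k < n)
    (if k == j then ovps_inj P (ovps_E P (a k)) else a k)).

(* The algebra over B generated by x, without adjunction of the unit: the
   polynomials in x with coefficients in B and no constant term.  With the unit
   in both algebras, Boolean independence would force E(x^2) = E(x 1 x) =
   E(x)^2, and similarly for the larger element in the monotone case.
   Independence of the algebras with units adjoined implies independence of
   these smaller ones. *)
Inductive gen_alg (P : ovps) (x : P) : P -> Prop :=
| gen_alg_gen : gen_alg x x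
| gen_alg_add a b : gen_alg x a -> gen_alg x b -> gen_alg x (a + b)
| gen_alg_mul a b : gen_alg x a -> gen_alg x b -> gen_alg x (a * b)
| gen_alg_left b a : gen_alg x a -> gen_alg x (ovps_inj P b * a)
| gen_alg_right a b : gen_alg x a -> gen_alg x (a * ovps_inj P b).

(* indexed by bool, with false < true: x has the smaller index *)
Definition gen_pair (P : ovps) (x y : P) (i : bool) : set P :=
  if i then gen_alg y else gen_alg x.

(* boolean_conv mu nu rho (resp. monotone_conv mu nu rho): rho is the law of a sum
   of independent realizations of mu and nu. *)
Definition boolean_conv (mu nu rho : sigma0) : Prop :=
  exists (P : ovps) (x y : P),
    [/\ selfadjoint x, selfadjoint y, has_law x mu & has_law y nu] /\
    boolean_independent (gen_pair x y) /\ has_law (x + y) rho.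

Definition monotone_conv (mu nu rho : sigma0) : Prop :=
  exists (P : ovps) (x y : P),
    [/\ selfadjoint x, selfadjoint y, has_law x mu & has_law y nu] /\
    monotone_independent (gen_pair x y) /\ has_law (x + y) rho.

(* A path [0,1] -> Sigma_0 is represented by a function on R, of which only the
   values on [0,1] matter: h tends to 0 with h <> 0 and t + h in [0,1]. *)
Definition in01 (t : R) : Prop := 0 <= t <= 1.

Definition increments (t : R) : set_system R :=
  within [set h : R | in01 (t + h)] (0 : R)^'.

Definition diff_quotient_n n (mu : R -> sigma0) (t : R) (b : 'M[B]_n) (h : R) :
    'M[B]_n :=
  map_mx (fun c => (h^-1)%:C *: c) (cauchyn (mu (t + h)) b - cauchyn (mu t) b).

Definition diff_quotient (mu : R -> sigma0) (t : R) (b : B) (h : R) : B :=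
  (h^-1)%:C *: (cauchy (mu (t + h)) b - cauchy (mu t) b).

Definition differentiable_path (mu : R -> sigma0) : Prop :=
  forall (n : nat) (t : R), in01 t ->
  exists Y : 'M[B]_n -> 'M[B]_n, forall b : B, upper_half b ->
  mxcnorm (diff_quotient_n mu t (b%:M) h - Y b%:M) @[h --> increments t]
    --> (0 : R).

Definition has_dcauchy (mu : R -> sigma0) (t : R) (b l : B) : Prop :=
  norm_cvg (increments t) (diff_quotient mu t b) l.

Definition dcauchy (mu : R -> sigma0) (t : R) (b : B) : B :=
  norm_lim (increments t) (diff_quotient mu t b).

End NCPoly.

(* Main.v *)
(* Positivity in a C*-algebra is handled through the norm: a selfadjoint [a] is
   positive iff [|l - a| <= l] for some [l >= 0].  Square roots of such elements
   come from the iteration [y := (t + y^2) / 2], and Kaplansky's theorem identifies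
   them with the elements [c^* c].  If [Im T >= e > 0], then [1 + i s T] is a strict
   contraction for a small [s > 0], so [T^-1] is a limit of polynomials in [T].
   Hence every resolvent [(b - x)^-1] is a limit of polynomials in [x], with an
   approximation which only depends on the law of [x] and on bounds: [G_mu] does not
   depend on the realization, and the independence relations extend to resolvents.

   Let [r] be the resolvent of [x + y], and [r_x], [r_y] those of [x], [y].  From
   [r = r_x (1 + y r)], Boolean independence gives [G = G_x (1 + E(y r))], and
   symmetrically [G = G_y (1 + E(x r))], while [b G = 1 + E(x r) + E(y r)]; so
   [(F_x + F_y - b) G = 1].  From [r = r_y (1 + x r)], monotone independence gives
   [E(a r) = E(a G_y (1 + x r))] for [a] in the algebra of [x]; the choice
   [a = (F_y - x)^-1 F_y] yields [G = G_x(F_y)].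

   Both formulas are then differentiated in [t].  For the second one, the bounds on
   resolvents make the Taylor expansion of [G_mu] at a point of the upper half-plane
   uniform in [mu]. *)
From mathcomp Require Import all_boot all_order all_algebra.
From mathcomp Require Import complex ring lra.
From mathcomp Require Import boolp classical_sets reals topology normedtype sequences.
Require Import Defs.

Set Implicit Arguments.
Unset Strict Implicit.
Unset Printing Implicit Defensive.

Import Order.TTheory GRing.Theory Num.Theory numFieldNormedType.Exports.

Local Open Scope classical_set_scope.
Local Open Scope complex_scope.
Local Open Scope ring_scope.

(** * Norm and limits *)

Section Norm.
Variables (R : realType) (A : cstarAlgType R).
Implicit Types (a b c : A) (l m : R) (z : R[i]).

Lemma normc_real l : Normc.normc l%:C = `|l|.
Proof. by rewrite /Normc.normc /= expr0n addr0 sqrtr_sqr. Qed.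

Lemma normc_i : Normc.normc ('i : R[i]) = 1.
Proof. by rewrite -complexiE /Normc.normc /= expr0n expr1n add0r sqrtr1. Qed.

Lemma conj_real l : (l%:C)^* = l%:C :> R[i].
Proof. by apply/CrealP; rewrite complex_real. Qed.

Lemma cnorm0 : cnorm (0 : A) = 0.
Proof. by rewrite -(scale0r (0 : A)) cnormZ Normc.normc0 mul0r. Qed.

Lemma cnormN a : cnorm (- a) = cnorm a.
Proof. by rewrite -scaleN1r cnormZ normcN Normc.normc1 mul1r. Qed.

Lemma cnormB_le a b : cnorm (a - b) <= cnorm a + cnorm b.
Proof. by rewrite -(cnormN b); exact: cnormD_le. Qed.

Lemma cnormBC a b : cnorm (a - b) = cnorm (b - a).
Proof. by rewrite -cnormN opprB. Qed.

Lemma cnorm_ge0 a : 0 <= cnorm a.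
Proof. by have := cnormB_le a a; rewrite subrr cnorm0 -mulr2n pmulrn_lge0. Qed.

Lemma cnormZr l a : cnorm (l%:C *: a) = `|l| * cnorm a.
Proof. by rewrite cnormZ normc_real. Qed.

Lemma cnorm_dist a b c : cnorm (a - c) <= cnorm (a - b) + cnorm (b - c).
Proof. by rewrite -{1}(subrK b a) -addrA; exact: cnormD_le. Qed.

Lemma starZr l a : star (l%:C *: a) = l%:C *: star a.
Proof. by rewrite starZ conj_real. Qed.

Lemma starN a : star (- a) = - star a.
Proof. by apply: (addrI (star a)); rewrite -starD !subrr star0. Qed.

Lemma starB a b : star (a - b) = star a - star b.
Proof. by rewrite starD starN. Qed.

Lemma starX a n : star (a ^+ n) = star a ^+ n.
Proof. by elim: n => [|n IHn]; rewrite ?star1 // exprS starM IHn -exprSr. Qed.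

Lemma cnorm1 : cnorm (1 : A) = 1.
Proof.
have := cnorm_starM (1 : A); rewrite star1 mulr1 expr2 => h.
have n0 : cnorm (1 : A) != 0.
  by apply/eqP => /cnorm0_eq0 /eqP; rewrite oner_eq0.
by apply: (mulfI n0); rewrite mulr1.
Qed.

Lemma cnorm_scalar l : cnorm (l%:C%:A : A) = `|l|.
Proof. by rewrite cnormZr cnorm1 mulr1. Qed.

Lemma cnorm_star a : cnorm (star a) = cnorm a.
Proof.
suff le b : cnorm b <= cnorm (star b).
  by apply/eqP; rewrite eq_le le -{2}(starK a) le.
have [->|n0] := eqVneq (cnorm b) 0; first exact: cnorm_ge0.
have gt0 : 0 < cnorm b by rewrite lt_def n0 cnorm_ge0.
by rewrite -(ler_pM2r gt0) -expr2 -cnorm_starM cnormM_le.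
Qed.

Lemma cnorm_sqr a : selfadjoint a -> cnorm (a ^+ 2) = cnorm a ^+ 2.
Proof. by move=> sa; rewrite -cnorm_starM sa -expr2. Qed.

Lemma selfadjointX a k : selfadjoint a -> selfadjoint (a ^+ k).
Proof. by move=> sa; rewrite /selfadjoint starX sa. Qed.

(** The $C^*$-identity iterated. It plays the role of the spectral radius formula: the growth of
    these powers bounds [cnorm a] itself. *)
Lemma cnorm_exp2 a k : selfadjoint a -> cnorm (a ^+ (2 ^ k)) = cnorm a ^+ (2 ^ k).
Proof.
move=> sa; elim: k => [|k IHk]; first by rewrite !expr1.
by rewrite expnSr !exprM cnorm_sqr ?IHk //; exact: selfadjointX.
Qed.

End Norm.

Section Limits.
Variables (R : realType) (T : Type) (F : set_system T).
Context {FF : Filter F}.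

Lemma norm_cvgP (A : cstarAlgType R) (f : T -> A) (l : A) :
  norm_cvg F f l <-> forall e : R, 0 < e -> \forall x \near F, cnorm (f x - l) < e.
Proof.
split=> [/cvgr0Pnorm_lt h e /h|h].
  by apply: filterS => x; rewrite ger0_norm // cnorm_ge0.
apply/cvgr0Pnorm_lt => e /h.
by apply: filterS => x; rewrite ger0_norm // cnorm_ge0.
Qed.

Lemma norm_cvg_dom (A : cstarAlgType R) (f : T -> A) (l : A) (g : T -> R) :
  (\forall x \near F, cnorm (f x - l) <= g x) -> g @ F --> (0 : R) ->
  norm_cvg F f l.
Proof.
move=> fg g0; apply/norm_cvgP => e e0.
have /cvgr0Pnorm_lt/(_ e e0) := g0.
by apply: filterS2 fg => x fx gx; apply: le_lt_trans fx (le_lt_trans (ler_norm _) gx).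
Qed.

Lemma norm_cvg_lip (A B : cstarAlgType R) (C : R) (g : A -> B) (f : T -> A) (l : A) :
  (forall a b, cnorm (g a - g b) <= C * cnorm (a - b)) ->
  norm_cvg F f l -> norm_cvg F (g \o f) (g l).
Proof.
move=> lip fl; apply: (@norm_cvg_dom _ _ _ (fun x => C * cnorm (f x - l))).
  by near=> x; exact: lip.
by rewrite -[X in _ --> X](mulr0 C); apply: cvgMr.
Unshelve. all: by end_near. Qed.

Section Algebra.
Variable A : cstarAlgType R.
Implicit Types (f g : T -> A) (l m a : A).

Lemma norm_cvg_cst a : norm_cvg F (fun=> a) a.
Proof. by rewrite /norm_cvg subrr cnorm0; exact: cvg_cst. Qed.

Lemma norm_cvg_near f g l :
  (\forall x \near F, f x = g x) -> norm_cvg F f l -> norm_cvg F g l.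
Proof.
move=> fg /norm_cvgP h; apply/norm_cvgP => e /h.
by apply: filterS2 fg => x ->.
Qed.

Lemma norm_cvgD f g l m :
  norm_cvg F f l -> norm_cvg F g m -> norm_cvg F (fun x => f x + g x) (l + m).
Proof.
move=> fl gm; apply: norm_cvg_dom (_ : (fun x => cnorm (f x - l) + cnorm (g x - m)) @ F --> _).
  by near=> x; rewrite opprD addrACA cnormD_le.
by rewrite -[X in _ --> X](addr0 0); apply: cvgD.
Unshelve. all: by end_near. Qed.

Lemma norm_cvgN f l : norm_cvg F f l -> norm_cvg F (fun x => - f x) (- l).
Proof.
by move=> fl; apply: norm_cvg_dom fl; near=> x; rewrite -opprD cnormN.
Unshelve. all: by end_near. Qed.

Lemma norm_cvgB f g l m :
  norm_cvg F f l -> norm_cvg F g m -> norm_cvg F (fun x => f x - g x) (l - m).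
Proof. by move=> fl gm; apply: norm_cvgD fl (norm_cvgN gm). Qed.

Lemma norm_cvg_bounded f l :
  norm_cvg F f l -> \forall x \near F, cnorm (f x) <= cnorm l + 1.
Proof.
move=> /norm_cvgP/(_ 1 ltr01); apply: filterS => x fx.
by rewrite -(subrK l (f x)) addrC; apply: le_trans (cnormD_le _ _) _; rewrite lerD2l ltW.
Qed.

Lemma norm_cvgM f g l m :
  norm_cvg F f l -> norm_cvg F g m -> norm_cvg F (fun x => f x * g x) (l * m).
Proof.
move=> fl gm; have gb := norm_cvg_bounded gm.
apply: norm_cvg_dom (_ : (fun x => cnorm (f x - l) * (cnorm m + 1) +
  cnorm l * cnorm (g x - m)) @ F --> _).
  apply: filterS gb => x gx.
  rewrite -(subrKA (l * g x)) -mulrBl -mulrBr.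
  apply: le_trans (cnormD_le _ _) _; apply: lerD; last exact: cnormM_le.
  by apply: le_trans (cnormM_le _ _) _; apply: ler_wpM2l => //; exact: cnorm_ge0.
have -> : nbhs (0 : R) = nbhs (0 * (cnorm m + 1) + cnorm l * 0).
  by rewrite mul0r mulr0 addr0.
by apply: cvgD; [apply: cvgMl|apply: cvgMr].
Unshelve. all: by end_near. Qed.

Lemma norm_cvg_star f l : norm_cvg F f l -> norm_cvg F (fun x => star (f x)) (star l).
Proof.
by move=> fl; apply: norm_cvg_dom fl; near=> x; rewrite -starB cnorm_star.
Unshelve. all: by end_near. Qed.

Lemma norm_cvgZ (z : R[i]) f l : norm_cvg F f l -> norm_cvg F (fun x => z *: f x) (z *: l).
Proof.
move=> fl; apply: norm_cvg_dom (_ : (fun x => Normc.normc z * cnorm (f x - l)) @ F --> _).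
  by near=> x; rewrite -scalerBr cnormZ.
by rewrite -[X in _ --> X](mulr0 (Normc.normc z)); apply: cvgMr.
Unshelve. all: by end_near. Qed.

Lemma norm_cvgV f l : (\forall x \near F, f x \is a GRing.unit) ->
  l \is a GRing.unit -> norm_cvg F f l -> norm_cvg F (fun x => (f x)^-1) l^-1.
Proof.
move=> fu lu fl; pose M := cnorm l^-1.
have M0 : 0 < M.
  rewrite lt_def cnorm_ge0 andbT; apply/eqP => /cnorm0_eq0 /eqP.
  by rewrite invr_eq0 => /eqP l0; rewrite l0 unitr0 in lu.
have /norm_cvgP/(_ (2 * M)^-1) := fl; rewrite invr_gt0 mulr_gt0 // => /(_ isT) near_l.
apply: norm_cvg_dom (_ : (fun x => 2 * M * M * cnorm (f x - l)) @ F --> _); last first.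
  by rewrite -[X in _ --> X](mulr0 (2 * M * M)); apply: cvgMr.
apply: filterS2 fu near_l => x xu xl.
have -> : (f x)^-1 - l^-1 = - ((f x)^-1 * (f x - l) * l^-1).
  by rewrite mulrBr mulVr // mulrBl mul1r -mulrA divrr // mulr1 opprB.
have le1 c : cnorm ((f x)^-1 * (f x - l) * c) <= cnorm (f x)^-1 * cnorm (f x - l) * cnorm c.
  apply: le_trans (cnormM_le _ _) _.
  by apply: ler_wpM2r (cnorm_ge0 _) _ _ (cnormM_le _ _).
suff bnd : cnorm (f x)^-1 <= 2 * M.
  rewrite cnormN; apply: le_trans (le1 _) _; rewrite -/M mulrAC.
  by apply: ler_wpM2r (cnorm_ge0 _) _ _ _; apply: ler_wpM2r bnd; rewrite ltW.
(* The bound is self-referential: closeness to [l] puts the coefficient 1/2 on the right, so half of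
   [cnorm (f x)^-1] is absorbed. *)
have : cnorm (f x)^-1 <= M + cnorm (f x)^-1 * (2 * M)^-1 * M.
  have {1}-> : (f x)^-1 = l^-1 - (f x)^-1 * (f x - l) * l^-1.
    by rewrite mulrBr mulVr // mulrBl mul1r -mulrA divrr // mulr1 opprB addrC subrK.
  apply: le_trans (cnormB_le _ _) _; rewrite lerD2l.
  apply: le_trans (le1 _) _; apply: ler_wpM2r (ltW M0) _ _ _.
  by apply: ler_wpM2l (cnorm_ge0 _) _ _ _; rewrite ltW.
rewrite invfM -!mulrA mulVf ?gt_eqF // mulr1; lra.
Qed.

End Algebra.
End Limits.

Section ProperLimits.
Variables (R : realType) (A : cstarAlgType R) (T : Type) (F : set_system T).
Context {FF : ProperFilter F}.
Implicit Types (f g : T -> A) (l m : A).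

Lemma norm_cvg_le f l (c : R) :
  (\forall x \near F, cnorm (f x) <= c) -> norm_cvg F f l -> cnorm l <= c.
Proof.
move=> fc /norm_cvgP fl; rewrite leNgt; apply/negP => lc.
have /fl h : 0 < cnorm l - c by rewrite subr_gt0.
have [x [fx fxl]] := filter_ex (filterI fc h).
have := cnorm_dist l (f x) 0; rewrite !subr0 cnormBC; lra.
Qed.

Lemma norm_cvg_unique f l m : norm_cvg F f l -> norm_cvg F f m -> l = m.
Proof.
move=> fl fm; apply/subr0_eq/cnorm0_eq0/eqP; rewrite eq_le cnorm_ge0 andbT.
apply: norm_cvg_le (norm_cvgB fl fm).
by near=> x; rewrite subrr cnorm0.
Unshelve. all: by end_near. Qed.

Lemma norm_lim_eq f l : norm_cvg F f l -> norm_lim F f = l.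
Proof.
move=> fl; rewrite /norm_lim; case: xgetP => [m _ /= fm|/(_ l)//].
exact: norm_cvg_unique fm fl.
Qed.

End ProperLimits.

Lemma subrDD (V : zmodType) (x y z : V) : x + y - (x + z) = y - z.
Proof. by rewrite opprD addrACA subrr add0r. Qed.

(** * Geometric series and square roots by iteration *)

Section Series.
Variables (R : realType) (A : cstarAlgType R).
Implicit Types (a b c t : A) (u : nat -> A) (v : nat -> R).

(** Method of majorants: [v] is monotone and bounded, hence Cauchy, and it dominates the increments
    of [u]. *)
Lemma norm_cvg_majorant u v (M : R) :
  (forall n, cnorm (u n.+1 - u n) <= v n.+1 - v n) -> (forall n, v n <= M) ->
  exists l, norm_cvg \oo u l.
Proof.
move=> uv vM.
have uv_le n k : cnorm (u (n + k)%N - u n) <= v (n + k)%N - v n.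
  elim: k => [|k IHk]; first by rewrite addn0 !subrr cnorm0.
  rewrite addnS; apply: le_trans (cnorm_dist _ (u (n + k)%N) _) _.
  by rewrite -[leRHS](subrKA (v (n + k)%N)); apply: lerD.
have v_nd : nondecreasing_seq v.
  move=> m n /subnKC <-; rewrite -subr_ge0.
  exact: le_trans (cnorm_ge0 _) (uv_le _ _).
have v_cvg : cvgn v.
  have ub : has_ubound (range v) by exists M => _ [n _ <-].
  exact: nondecreasing_is_cvgn v_nd ub.
have uv_lim m n : cnorm (u m - u n) <= `|v m - v n|.
  have [/subnKC <-|/ltnW/subnKC <-] := leqP n m.
    by apply: le_trans (uv_le _ _) (ler_norm _).
  by rewrite cnormBC distrC; apply: le_trans (uv_le _ _) (ler_norm _).
have cauchy_u (e : R) : 0 < e -> exists N, forall m n, (N <= m)%N -> (N <= n)%N ->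
    cnorm (u m - u n) < e.
  move=> e0; have /cvgrPdist_lt/(_ (e / 2)) := v_cvg.
  rewrite divr_gt0 // => /(_ isT) [N _ vN]; exists N => m n /vN vm /vN vn.
  apply: le_lt_trans (uv_lim _ _) _; rewrite -(subrKA (limn v)).
  by apply: le_lt_trans (ler_normD _ _) _; rewrite distrC (splitr e) ltrD.
have [l ul] := cnorm_complete u cauchy_u.
exists l; apply/norm_cvgP => e /ul [N uN].
by exists N => // n /= /uN.
Qed.

Lemma norm_cvg_iter (g : A -> A) l (a0 : A) :
  norm_cvg \oo (fun n => iter n g a0) l ->
  norm_cvg \oo (fun n => g (iter n g a0)) l.
Proof.
move=> /norm_cvgP gl; apply/norm_cvgP => e /gl [N _ gN].
by exists N => // n /= Nn; apply: (gN n.+1); rewrite /= leqW.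
Qed.

Lemma norm_cvg_comm u l c :
  (forall n, u n * c = c * u n) -> norm_cvg \oo u l -> l * c = c * l.
Proof.
move=> uc ul.
have lc : norm_cvg \oo (fun n => u n * c) (l * c).
  by apply: norm_cvgM ul _; exact: norm_cvg_cst.
have cl : norm_cvg \oo (fun n => c * u n) (c * l).
  by apply: norm_cvgM ul; exact: norm_cvg_cst.
apply: norm_cvg_unique lc _; apply: norm_cvg_near cl.
by near=> n; rewrite uc.
Unshelve. all: by end_near. Qed.

Lemma norm_cvg_selfadjoint u l :
  (forall n, selfadjoint (u n)) -> norm_cvg \oo u l -> selfadjoint l.
Proof.
move=> us ul; apply: norm_cvg_unique (norm_cvg_star ul) _.
by apply: norm_cvg_near ul; near=> n; rewrite us.
Unshelve. all: by end_near. Qed.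

(** The iterates are partial sums of the geometric series, majorized by the same iteration on reals
    with [q]. Their convergence exhibits the inverse as a limit of polynomials in [a]. *)
Lemma neumann a (q : R) : cnorm a <= q -> q < 1 ->
  [/\ 1 - a \is a GRing.unit, cnorm (1 - a)^-1 <= (1 - q)^-1
    & norm_cvg \oo (fun n => iter n (fun y => 1 + a * y) 0) (1 - a)^-1].
Proof.
move=> aq q1; set u := fun n => iter n _ 0.
pose v n := iter n (fun y : R => 1 + q * y) 0.
have q0 : 0 <= q by apply: le_trans aq; exact: cnorm_ge0.
have q10 : 0 < 1 - q by rewrite subr_gt0.
have vM n : v n <= (1 - q)^-1.
  elim: n => [|n IHn] /=; first by rewrite invr_ge0 ltW.
  have -> : (1 - q)^-1 = 1 + q * (1 - q)^-1 by field; rewrite gt_eqF.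
  by rewrite lerD2l ler_wpM2l.
have uv n : cnorm (u n.+1 - u n) <= v n.+1 - v n.
  elim: n => [|n IHn] /=.
    by rewrite !mulr0 !addr0 !subr0 cnorm1.
  rewrite !subrDD -!mulrBr.
  by apply: le_trans (cnormM_le _ _) _; apply: ler_pM => //; exact: cnorm_ge0.
have uv_le n : cnorm (u n) <= v n.
  elim: n => [|n IHn] /=; first by rewrite cnorm0.
  apply: le_trans (cnormD_le _ _) _; rewrite cnorm1 lerD2l.
  by apply: le_trans (cnormM_le _ _) _; apply: ler_pM => //; exact: cnorm_ge0.
have uc n : u n * a = a * u n.
  elim: n => [|n IHn] /=; first by rewrite mulr0 mul0r.
  by rewrite mulrDl mulrDr mul1r mulr1 -mulrA IHn.
have [l ul] := norm_cvg_majorant uv vM.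
have lE : l = 1 + a * l.
  apply: norm_cvg_unique (norm_cvg_iter ul) _.
  by apply: norm_cvgD; [exact: norm_cvg_cst|apply: norm_cvgM ul; exact: norm_cvg_cst].
have la := norm_cvg_comm uc ul.
have l1 : (1 - a) * l = 1 by rewrite mulrBl mul1r {1}lE addrK.
have l2 : l * (1 - a) = 1 by rewrite mulrBr mulr1 la {1}lE addrK.
have aU : 1 - a \is a GRing.unit by apply/unitrP; exists l.
have lV : (1 - a)^-1 = l by apply: (mulrI aU); rewrite divrr.
rewrite lV; split=> //; apply: norm_cvg_le ul.
by near=> n; apply: le_trans (uv_le n) (vM n).
Unshelve. all: by end_near. Qed.

(* The iteration [y := (t + y^2) / 2] converges to [1 - sqrt (1 - t)]; it is
   dominated by the same iteration for [t = 1] on real numbers. *)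
Lemma sqrt_one_sub t : selfadjoint t -> cnorm t <= 1 ->
  exists r, [/\ selfadjoint r, r ^+ 2 = 1 - t, cnorm (1 - r) <= 1
    & forall c, t * c = c * t -> r * c = c * r].
Proof.
move=> st t1; pose h : R := 2^-1.
pose g (y : A) := h%:C *: (t + y * y); pose u n := iter n g 0.
pose v n := iter n (fun y : R => h * (1 + y * y)) 0.
have h0 : 0 < h by rewrite invr_gt0.
have v0 n : 0 <= v n.
  case: n => //= n; apply: mulr_ge0; first exact: ltW.
  by apply: addr_ge0 => //; exact: sqr_ge0.
have vM n : v n <= 1.
  elim: n => //= n IHn; rewrite /h ler_pdivrMl // mulr1 lerD2l.
  by rewrite -[leRHS]mulr1; apply: ler_pM.
have ut n : u n * t = t * u n.
  elim: n => [|n IHn] /=; first by rewrite mul0r mulr0.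
  by rewrite /g -scalerAl -scalerAr mulrDl mulrDr -mulrA IHn mulrA IHn mulrA.
have uc c : t * c = c * t -> forall n, u n * c = c * u n.
  move=> tc; elim=> [|n IHn] /=; first by rewrite mul0r mulr0.
  by rewrite /g -scalerAl -scalerAr mulrDl mulrDr -mulrA IHn mulrA IHn mulrA tc.
have uv n : cnorm (u n) <= v n.
  elim: n => [|n IHn] /=; first by rewrite cnorm0.
  rewrite cnormZr gtr0_norm // ler_pM2l //; apply: le_trans (cnormD_le _ _) _.
  by apply: lerD => //; apply: le_trans (cnormM_le _ _) _; apply: ler_pM => //;
     exact: cnorm_ge0.
have uS n : u n * u n.+1 = u n.+1 * u n.
  by apply: uc => //; rewrite ut.
have duv n : cnorm (u n.+1 - u n) <= v n.+1 - v n.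
  elim: n => [|n IHn].
    rewrite /= /g mulr0 addr0 subr0 mulr0 addr0 subr0 cnormZr gtr0_norm //.
    by apply: ler_wpM2l => //; exact: ltW.
  (* The difference of squares factors because consecutive iterates commute. *)
  have -> : u n.+2 - u n.+1 = h%:C *: ((u n.+1 + u n) * (u n.+1 - u n)).
    rewrite [u n.+2]/= -/(u n.+1) {2}[u n.+1]/= /g -scalerBr subrDD; congr (_ *: _).
    by rewrite mulrBr !mulrDl uS addrKA.
  have -> : v n.+2 - v n.+1 = h * ((v n.+1 + v n) * (v n.+1 - v n)).
    have vS k : v k.+1 = h * (1 + v k * v k) by [].
    by rewrite (vS n.+1) [X in _ - X = _]vS; ring.
  rewrite cnormZr gtr0_norm // ler_pM2l //; apply: le_trans (cnormM_le _ _) _.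
  apply: ler_pM => //; try exact: cnorm_ge0.
  by apply: le_trans (cnormD_le _ _) _; apply: lerD.
have [y uy] := norm_cvg_majorant duv vM.
have yE : y = h%:C *: (t + y * y).
  apply: norm_cvg_unique (norm_cvg_iter uy) _.
  apply: norm_cvgZ; apply: norm_cvgD; first exact: norm_cvg_cst.
  exact: norm_cvgM.
exists (1 - y); split.
- rewrite /selfadjoint starB star1; congr (_ - _).
  apply: norm_cvg_selfadjoint uy; elim=> [|n IHn]; first exact: star0.
  by rewrite /selfadjoint /= /g starZr starD starM IHn st.
(* The fixed point equation $2y = t + y^2$ says $(1-y)^2 = 1-t$. *)
- have yy : y + y = t + y * y.
    rewrite -[y in y + _]scale1r -[y in _ + y]scale1r -scalerDl {1}yE scalerA.
    rewrite (_ : (1 + 1) * h%:C = 1) ?scale1r //.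
    by rewrite -(rmorph1 (real_complex R)) -rmorphD -rmorphM mulfV // -[1 + 1]/(2%:R) pnatr_eq0.
  have -> : t = y + y - y * y by rewrite yy addrK.
  by rewrite expr2 mulrBr mulr1 mulrBl mul1r !opprB opprD -addrA [- y + _]addrCA.
- rewrite opprB addrC subrK; apply: norm_cvg_le uy.
  by near=> n; apply: le_trans (uv n) (vM n).
- by move=> c tc; rewrite mulrBl mulrBr mul1r mulr1 (norm_cvg_comm (uc c tc) uy).
Unshelve. all: by end_near. Qed.

End Series.

(** * Positive elements *)

Lemma bernoulli (R : realType) (x : R) n : 0 <= x -> 1 + n%:R * x <= (1 + x) ^+ n.
Proof.
move=> x0; elim: n => [|n IHn]; first by rewrite mul0r addr0 expr0.
rewrite exprS -natr1; have := ler_wpM2l x0 IHn.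
have : 0 <= n%:R * x * x by rewrite !mulr_ge0.
nra.
Qed.

Lemma le1_of_linear_growth (R : realType) (x c : R) : 0 <= c ->
  (forall k, x ^+ (2 ^ k) <= 1 + (2 ^ k)%:R * c) -> x <= 1.
Proof.
move=> c0 h; rewrite leNgt; apply/negP => x1; pose d := x - 1.
have d0 : 0 < d by rewrite subr_gt0.
(* Chosen so that $M > y$ forces $M d^2 > 2c+1$. By Bernoulli's inequality at exponent $M$, squared,
   $(1+Md)^2 \le (1+d)^{2M} \le 1 + 2Mc$, which is then impossible. *)
pose y := (2 * c + 1) / d ^+ 2 + 1.
have y0 : 0 <= y by rewrite addr_ge0 // divr_ge0 ?sqr_ge0 // addr_ge0 // mulr_ge0.
pose m := Num.bound y; pose M : R := (2 ^ m)%:R.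
have ym : y < M.
  apply: lt_le_trans (archi_boundP y0) _.
  by rewrite ler_nat ltnW // ltn_expl.
have M1 : 1 < M by apply: le_lt_trans ym; rewrite lerDr divr_ge0 ?sqr_ge0 // addr_ge0 // mulr_ge0.
have hM : 2 * c + 1 < M * d ^+ 2.
  rewrite -ltr_pdivrMr ?exprn_gt0 //; apply: le_lt_trans ym; rewrite /y; lra.
have := h m.+1; rewrite expnSr exprM natrM -/M.
have -> : x = 1 + d by rewrite /d addrC subrK.
have := bernoulli (2 ^ m)%N (ltW d0); rewrite -/M.
set e := (1 + d) ^+ _ => be le.
have M0 : 0 < M by apply: lt_trans M1.
have Md : 0 < M * d by rewrite mulr_gt0.
have : (1 + M * d) ^+ 2 <= e ^+ 2.
  by rewrite lerXn2r ?nnegrE //; lra.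
nra.
Qed.

Section Positivity.
Variables (R : realType) (A : cstarAlgType R).
Implicit Types (a b c d r : A) (l m : R).

(* An order-theoretic description of positivity through the norm: unlike
   [positive], it defines a convex cone in an obvious way. *)
Definition pos a := selfadjoint a /\ exists2 l : R, 0 <= l & cnorm (l%:C%:A - a) <= l.

Lemma selfadjoint_scalar l : selfadjoint (l%:C%:A : A).
Proof. by rewrite /selfadjoint starZr star1. Qed.

Lemma selfadjointB a b : selfadjoint a -> selfadjoint b -> selfadjoint (a - b).
Proof. by rewrite /selfadjoint starB => -> ->. Qed.

Lemma selfadjointD a b : selfadjoint a -> selfadjoint b -> selfadjoint (a + b).
Proof. by rewrite /selfadjoint starD => -> ->. Qed.

Lemma selfadjointZ l a : selfadjoint a -> selfadjoint (l%:C *: a).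
Proof. by rewrite /selfadjoint starZr => ->. Qed.

Lemma selfadjoint_starM c : selfadjoint (star c * c).
Proof. by rewrite /selfadjoint starM starK. Qed.

Lemma scalarD l m : (l + m)%:C%:A = l%:C%:A + m%:C%:A :> A.
Proof. by rewrite rmorphD scalerDl. Qed.

Lemma scalarB l m : (l - m)%:C%:A = l%:C%:A - m%:C%:A :> A.
Proof. by rewrite rmorphB scalerBl. Qed.

Lemma posD a b : pos a -> pos b -> pos (a + b).
Proof.
move=> [sa [l l0 la]] [sb [m m0 mb]]; split; first exact: selfadjointD.
exists (l + m); first exact: addr_ge0.
by rewrite scalarD opprD addrACA; apply: le_trans (cnormD_le _ _) (lerD la mb).
Qed.

Lemma posZ l a : 0 <= l -> pos a -> pos (l%:C *: a).
Proof.
move=> l0 [sa [m m0 ma]]; split; first exact: selfadjointZ.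
exists (l * m); first exact: mulr_ge0.
by rewrite rmorphM -scalerA -scalerBr cnormZr ger0_norm // ler_wpM2l.
Qed.

Lemma pos_scalar l : 0 <= l -> pos (l%:C%:A).
Proof.
move=> l0; split; first exact: selfadjoint_scalar.
by exists l => //; rewrite subrr cnorm0.
Qed.

Lemma cnorm_le_pos l a : selfadjoint a -> cnorm a <= l -> pos (l%:C%:A - a).
Proof.
move=> sa al; split; first exact: selfadjointB (selfadjoint_scalar _) sa.
exists l; first by apply: le_trans al; exact: cnorm_ge0.
by rewrite subKr.
Qed.

(** After rescaling, $a = l(1-t)$ with $\|t\| \le 1$. The commutation clause serves to make roots of
    commuting elements commute. *)
Lemma pos_sqrt a : pos a -> exists r, [/\ pos r, r ^+ 2 = a
  & forall c, a * c = c * a -> r * c = c * r].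
Proof.
move=> [sa [l l0 la]]; have [l_eq0|ln0] := eqVneq l 0.
  have a0 : a = 0.
    move: la; rewrite l_eq0 scale0r sub0r cnormN => a0.
    by apply/cnorm0_eq0/eqP; rewrite eq_le a0 cnorm_ge0.
  exists 0; split; rewrite ?a0 ?expr0n //.
  by rewrite -(scale0r 1); exact: pos_scalar.
have {}l0 : 0 < l by rewrite lt_def ln0.
pose t := 1 - l^-1%:C *: a.
have tE : t = l^-1%:C *: (l%:C%:A - a).
  by rewrite scalerBr scalerA -rmorphM mulVf // scale1r.
have st : selfadjoint t.
  by rewrite tE; apply: selfadjointZ; exact: selfadjointB (selfadjoint_scalar _) sa.
have t1 : cnorm t <= 1.
  by rewrite tE cnormZr gtr0_norm ?invr_gt0 // ler_pdivrMl // mulr1.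
have [r [sr r2 r1 rc]] := sqrt_one_sub st t1.
pose q := Num.sqrt l; have qq : q * q = l by rewrite -expr2 sqr_sqrtr // ltW.
exists (q%:C *: r); split.
- apply: posZ; first exact: sqrtr_ge0.
  by split=> //; exists 1; rewrite ?scale1r.
- rewrite expr2 -scalerAl -scalerAr scalerA -rmorphM qq -expr2 r2 /t subKr.
  by rewrite scalerA -rmorphM mulfV // scale1r.
- move=> c ac; rewrite -scalerAl -scalerAr rc // /t mulrBl mulrBr mul1r mulr1.
  by rewrite -scalerAl -scalerAr ac.
Qed.

(* [r + i s] is normal, with square norm [l]. *)
Lemma cnorm_sqr_sum l r s : selfadjoint r -> selfadjoint s -> r * s = s * r ->
  0 <= l -> r ^+ 2 + s ^+ 2 = l%:C%:A -> cnorm r ^+ 2 <= l.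
Proof.
move=> sr ss rs l0 rsl; pose z := r + 'i *: s.
have sz : star z = r - 'i *: s by rewrite starD starZ sr ss conjCi scaleNr.
have zz : star z * z = l%:C%:A.
  rewrite sz mulrBl !mulrDr -!scalerAl -!scalerAr rs opprD addrA addrK.
  by rewrite scalerA -(expr2 'i) sqrCi scaleN1r opprK -!expr2.
have z2 : cnorm z ^+ 2 = l by rewrite -cnorm_starM zz cnorm_scalar ger0_norm.
have : 2 * cnorm r <= 2 * cnorm z.
  rewrite -[leLHS]ger0_norm ?mulr_ge0 ?cnorm_ge0 // normrM (ger0_norm (cnorm_ge0 _)).
  rewrite -cnormZr (_ : 2%:C *: r = z + star z).
    by rewrite mulr_natl mulr2n -{2}(cnorm_star z); exact: cnormD_le.
  by rewrite sz addrACA subrr addr0 rmorph_nat scaler_nat mulr2n.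
rewrite ler_pM2l // => rz; rewrite -z2 lerXn2r ?nnegrE ?cnorm_ge0 //.
Qed.

Lemma scalar_comm l a : l%:C%:A * a = a * l%:C%:A.
Proof. by rewrite mulr_algl mulr_algr. Qed.

Lemma comm_scalarB l a b : a * b = b * a -> (l%:C%:A - a) * b = b * (l%:C%:A - a).
Proof. by move=> ab; rewrite mulrBl mulrBr scalar_comm ab. Qed.

(** With $l = \|a\|^2$, the root $v$ of $l - a^2$ commutes with $a$ and $v^2 + a^2 = l$, so $\|l -
    a^2\| = \|v\|^2 \le l$. *)
Lemma pos_sqr a : selfadjoint a -> pos (a ^+ 2).
Proof.
move=> sa; pose l := cnorm a ^+ 2; have l0 : 0 <= l by exact: sqr_ge0.
have sa2 := selfadjointX 2 sa.
have [|v [[sv _] v2 vc]] := @pos_sqrt (l%:C%:A - a ^+ 2).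
  by apply: cnorm_le_pos => //; rewrite cnorm_sqr.
split=> //; exists l => //; rewrite -v2 cnorm_sqr //.
apply: (@cnorm_sqr_sum _ _ a) => //; last by rewrite v2 subrK.
by apply: vc; apply: comm_scalarB; rewrite -exprS -exprSr.
Qed.

(** The roots of $a$ and $l-a$ commute and their squares add up to $l$. *)
Lemma pos_cnorm_le l a : 0 <= l -> pos a -> pos (l%:C%:A - a) -> cnorm a <= l.
Proof.
move=> l0 pa pla; have [r [[sr _] ra rc]] := pos_sqrt pa.
have [v [[sv _] vla vc]] := pos_sqrt pla.
rewrite -ra cnorm_sqr //; apply: (@cnorm_sqr_sum _ _ v) => //; last first.
  by rewrite ra vla addrC subrK.
by apply: rc; apply/esym/vc; exact: comm_scalarB.
Qed.

Lemma pos_antisym a : pos a -> pos (- a) -> a = 0.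
Proof.
move=> pa pna; apply/cnorm0_eq0/eqP; rewrite eq_le cnorm_ge0 andbT.
by apply: pos_cnorm_le => //; rewrite scale0r sub0r.
Qed.

(* The [N]-th power of [m + d d^*] is at most of the order of [N m^N] when the norm
   of [m + d^* d] is at most [m], so the norm of [m + d d^*] is at most [m] too. *)
Lemma pos_oppM d : pos (- (star d * d)) -> pos (- (d * star d)).
Proof.
case=> _ [l l0 hl]; have sdd : selfadjoint (d * star d).
  by rewrite /selfadjoint starM starK.
split; first by rewrite /selfadjoint starN sdd.
(* Adding 1 makes division by $m$ possible even when $l = 0$. *)
pose m := l + 1; have m0 : 0 < m by rewrite ltr_wpDl.
exists m; first exact: ltW.
rewrite opprK; set T := _ + _.
have sT : selfadjoint T by exact: selfadjointD (selfadjoint_scalar _) sdd.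
have {}hl : cnorm (m%:C%:A + star d * d) <= m.
  rewrite /m scalarD addrAC; apply: le_trans (cnormD_le _ _) _.
  by rewrite cnorm_scalar normr1 lerD2r -{1}[star d * d]opprK.
(* The recursion is $Q_{N+1} = (m + d^*d) Q_N + m^N$: only $m + d^*d$, whose norm is controlled,
   multiplies $Q_N$. *)
have powT N : exists Q, T ^+ N = (m ^+ N)%:C%:A + d * Q * star d /\
    cnorm Q * m <= N%:R * m ^+ N.
  elim: N => [|N [Q [TQ Qm]]].
    by exists 0; rewrite mulr0 mul0r addr0 scale1r cnorm0 !mul0r.
  exists ((m%:C%:A + star d * d) * Q + (m ^+ N)%:C%:A); split.
    rewrite !(mulrDl, mulrDr) !mulr_algl mulr_algr -!scalerAr -!scalerAl !mulrA.
    rewrite exprS TQ /T mulrDl mulr_algl scalerDr scalerA -rmorphM -exprS.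
    rewrite mulrDr mulr_algr !mulrA -!addrA; congr (_ + (_ + _)); exact: addrC.
  apply: le_trans (ler_wpM2r (ltW m0) (cnormD_le _ _)) _.
  rewrite mulrDl cnorm_scalar ger0_norm ?exprn_ge0 ?(ltW m0) // -exprSr.
  rewrite -natr1 (mulrDl N%:R) mul1r lerD2r exprS mulrCA.
  apply: le_trans (ler_wpM2r (ltW m0) (cnormM_le _ _)) _; rewrite -mulrA.
  by apply: ler_pM => //; rewrite ?cnorm_ge0 ?mulr_ge0 ?cnorm_ge0 ?(ltW m0).
suff : cnorm T / m <= 1 by rewrite ler_pdivrMr // mul1r.
apply: (@le1_of_linear_growth _ _ (cnorm d ^+ 2 / m)) => [|k].
  by rewrite divr_ge0 ?sqr_ge0 ?(ltW m0).
have [Q [TQ Qm]] := powT (2 ^ k)%N.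
rewrite expr_div_n -cnorm_exp2 // TQ ler_pdivrMr ?exprn_gt0 // mulrDl mul1r.
apply: le_trans (cnormD_le _ _) _.
rewrite cnorm_scalar ger0_norm ?exprn_ge0 ?(ltW m0) // lerD2l.
have -> : (2 ^ k)%:R * (cnorm d ^+ 2 / m) * m ^+ (2 ^ k) =
  (cnorm d ^+ 2) * ((2 ^ k)%:R * m ^+ (2 ^ k)) / m by field; rewrite gt_eqF.
rewrite ler_pdivlMr //.
apply: le_trans (_ : cnorm d * cnorm Q * cnorm d * m <= _).
  apply: ler_wpM2r (ltW m0) _ _ _; apply: le_trans (cnormM_le _ _) _.
  rewrite cnorm_star; apply: ler_wpM2r (cnorm_ge0 _) _ _ _; exact: cnormM_le.
have -> : cnorm d * cnorm Q * cnorm d * m = cnorm d ^+ 2 * (cnorm Q * m) by ring.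
by apply: ler_wpM2l => //; exact: sqr_ge0.
Qed.

(** With [h] and [k] twice the real and (up to sign) imaginary parts of [d], $h^2 + k^2 = 2 d^* d +
    2 d d^*$. Since $-d d^*$ is positive, so is $2 d^* d = h^2 + k^2 - 2 d d^*$, and antisymmetry
    gives $d^* d = 0$. *)
Lemma pos_opp_starM d : pos (- (star d * d)) -> d = 0.
Proof.
move=> nd; have nd' := pos_oppM nd.
pose h := d + star d; pose k := 'i *: (d - star d).
have sh : selfadjoint h by rewrite /selfadjoint starD starK addrC.
have sk : selfadjoint k.
  by rewrite /selfadjoint starZ conjCi starB starK scaleNr -scalerN opprB.
have hk : h ^+ 2 + k ^+ 2 = 2%:C *: (star d * d + d * star d).
  have -> : h ^+ 2 = (d * d + star d * star d) + (star d * d + d * star d).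
    rewrite expr2 mulrDl !mulrDr [star d * d + star d * star d]addrC addrACA.
    by congr (_ + _); exact: addrC.
  have -> : k ^+ 2 = (star d * d + d * star d) - (d * d + star d * star d).
    rewrite expr2 -scalerAl -scalerAr scalerA -(expr2 'i) sqrCi scaleN1r.
    rewrite mulrBl !mulrBr (opprB (star d * d)) addrACA -opprD opprB.
    by congr (_ - _); exact: addrC.
  rewrite [_ + (star d * d + _)]addrC -addrA [X in _ + X]addrC subrK.
  by rewrite rmorph_nat scaler_nat mulr2n.
have pd : pos (star d * d).
  have p2 : pos (2%:C *: (star d * d)).
    have -> : 2%:C *: (star d * d) = (h ^+ 2 + k ^+ 2) + 2%:C *: (- (d * star d)).
      by rewrite hk scalerN -scalerBr addrK.
    by apply: posD; [apply: posD; exact: pos_sqr|apply: posZ].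
  have -> : star d * d = (2^-1)%:C *: (2%:C *: (star d * d)).
    by rewrite scalerA -rmorphM mulVf ?pnatr_eq0 // scale1r.
  by apply: posZ => //; rewrite invr_ge0.
apply: cnorm0_eq0; apply/eqP; rewrite -sqrf_eq0 -cnorm_starM.
by rewrite (pos_antisym pd nd) cnorm0.
Qed.

(* With [a = c^* c] and [r = |a|], the difference [n = r - a] satisfies
   [a n = - r n], so [- (c n)^* (c n) = r n^2] is positive and [c n = 0]. *)
Lemma pos_starM c : pos (star c * c).
Proof.
set a := star c * c; have sa : selfadjoint a by exact: selfadjoint_starM.
have [r [pr ra2 rc]] := pos_sqrt (pos_sqr sa); have sr : selfadjoint r by case: pr.
have ra : r * a = a * r by apply: rc; rewrite -exprS -exprSr.
have [s [[ss _] sr2 sc]] := pos_sqrt pr.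
pose n := r - a; have sn : selfadjoint n by exact: selfadjointB.
have rn : r * n = n * r by rewrite /n mulrBl mulrBr ra.
have an : a * n = - (r * n).
  by rewrite /n !mulrBr opprB ra -expr2 -!ra2 expr2.
have sn_comm : s * n = n * s by apply: sc.
have nrn : n * (r * n) = (s * n) ^+ 2.
  by rewrite -sr2 !expr2 !mulrA -sn_comm.
have cn0 : c * n = 0.
  apply: pos_opp_starM; rewrite starM sn -mulrA (mulrA (star c)) -/a an mulrN opprK nrn.
  by apply: pos_sqr; rewrite /selfadjoint starM ss sn -sn_comm.
have nrn0 : n * (r * n) = 0.
  by apply/eqP; rewrite -oppr_eq0 -mulrN -an /a -mulrA cn0 !mulr0.
have n2 : n ^+ 2 = r * n + r * n.
  by rewrite expr2 {1}/n mulrBl an opprK.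
have n4 : n ^+ (2 ^ 2) = 0.
  by rewrite (exprD n 2 2) {2}n2 mulrDr expr2 -!mulrA nrn0 !mulr0 addr0.
suff n0 : n = 0 by rewrite -(subr0_eq n0).
apply: cnorm0_eq0; apply/eqP.
have := cnorm_exp2 2 sn; rewrite n4 cnorm0 => /esym/eqP.
by rewrite expf_eq0 => /andP[].
Qed.

(** Kaplansky's theorem in one direction, the square root in the other. *)
Lemma positiveP a : positive a <-> pos a.
Proof.
split=> [[c ->]|/pos_sqrt[r [[sr _] <- _]]]; first exact: pos_starM.
by exists r; rewrite sr expr2.
Qed.

Lemma pos_conj a c : pos a -> pos (star c * a * c).
Proof.
move=> /pos_sqrt[r [[sr _] <- _]].
have -> : star c * r ^+ 2 * c = star (r * c) * (r * c).
  by rewrite starM sr expr2 !mulrA.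
exact: pos_starM.
Qed.

End Positivity.

(** * The upper half-plane *)

Section UpperHalf.
Variables (R : realType) (A : cstarAlgType R).
Implicit Types (a b T : A) (e M : R).

Lemma cnorm_unit_gt0 a : a \is a GRing.unit -> 0 < cnorm a.
Proof.
move=> aU; rewrite lt_def cnorm_ge0 andbT; apply/eqP => /cnorm0_eq0 a0.
by rewrite a0 unitr0 in aU.
Qed.

Lemma starV a : a \is a GRing.unit -> star a^-1 = (star a)^-1.
Proof.
move=> aU.
have l1 : star a * star a^-1 = 1 by rewrite -starM mulVr // star1.
have l2 : star a^-1 * star a = 1 by rewrite -starM divrr // star1.
have sU : star a \is a GRing.unit by apply/unitrP; exists (star a^-1).
by apply: (mulrI sU); rewrite l1 divrr.
Qed.

Lemma double_i_neq0 : 2 * 'i != 0 :> R[i].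
Proof. by rewrite mulf_neq0 ?pnatr_eq0 // neq0Ci. Qed.

Lemma impartE a : a - star a = (2 * 'i) *: impart a.
Proof. by rewrite scalerA mulfV ?scale1r // double_i_neq0. Qed.

Lemma impartD a b : impart (a + b) = impart a + impart b.
Proof. by rewrite /impart starD opprD addrACA scalerDr. Qed.

Lemma selfadjoint_impart a : selfadjoint (impart a).
Proof.
rewrite /selfadjoint /impart starZ starB starK -[in RHS]opprB scalerN -scaleNr.
by congr (_ *: _); rewrite fmorphV rmorphM rmorph_nat /= conjCi mulrN invrN.
Qed.

Lemma impart_selfadjoint a : selfadjoint a -> impart a = 0.
Proof. by move=> sa; rewrite /impart sa subrr scaler0. Qed.

Lemma impart_eq a b : a - star a = (2 * 'i) *: b -> impart a = b.
Proof. by rewrite /impart => ->; rewrite scalerA mulVf ?scale1r // double_i_neq0. Qed.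

Lemma real_complex_double (l : R) : (2 * l)%:C = 2 * l%:C :> R[i].
Proof. by rewrite rmorphM rmorph_nat. Qed.

Lemma conj_iM (l : R) : ('i * l%:C)^* = - ('i * l%:C) :> R[i].
Proof. by rewrite rmorphM /= conjCi mulNr [X in _ * X]conj_real. Qed.

Definition above e a := pos (impart a - e%:C%:A).

(* For [s = e / M^2], the square norm of [1 + i s T] is that of
   [1 - 2 s Im T + s^2 T^* T], a positive element below [1 - 2 s e + s^2 M^2]. *)
Lemma above_contraction T e M : 0 < e -> e <= M -> cnorm T <= M -> above e T ->
  cnorm (1 - (- 'i * (e / M ^+ 2)%:C) *: T) <= Num.sqrt (1 - (e / M) ^+ 2).
Proof.
move=> e0 eM TM Te; have M0 : 0 < M by exact: lt_le_trans eM.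
pose t := e / M ^+ 2; rewrite -/t mulNr scaleNr opprK; set z := _ + _.
have t0 : 0 <= t by rewrite divr_ge0 ?sqr_ge0 ?ltW.
have q0 : 0 <= 1 - (e / M) ^+ 2.
  by rewrite subr_ge0 expr_le1 ?divr_ge0 ?ler_pdivrMr ?mul1r // ltW.
rewrite -ler_sqr ?nnegrE ?cnorm_ge0 ?sqrtr_ge0 // sqr_sqrtr // -cnorm_starM.
apply: pos_cnorm_le => //; first exact: pos_starM.
have zz : star z * z = 1 - (2 * t)%:C *: impart T + (t ^+ 2)%:C *: (star T * T).
  rewrite /z starD star1 starZ conj_iM scaleNr.
  rewrite mulrBl mul1r mulrDr mulr1 -[LHS]addrA -[RHS]addrA; congr (1 + _).
  rewrite -scalerAl -scalerAr scalerA opprD addrA -scalerBr impartE scalerA.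
  congr (_ + _).
    rewrite -scaleNr; congr (_ *: _).
    by rewrite mulrCA mulrAC -expr2 sqrCi mulN1r mulrN; congr (- _); rewrite -real_complex_double.
  rewrite -scaleNr; congr (_ *: _).
  by rewrite mulrACA -expr2 sqrCi mulN1r opprK -expr2 rmorphXn.
(* As $t = e/M^2$, the scalar equals $1 - 2te + t^2M^2$, so the difference splits into two positive
   elements. *)
have -> : (1 - (e / M) ^+ 2)%:C%:A - star z * z =
  (2 * t)%:C *: (impart T - e%:C%:A) + (t ^+ 2)%:C *: ((M ^+ 2)%:C%:A - star T * T).
  have -> : 1 - (e / M) ^+ 2 = 1 - 2 * t * e + t ^+ 2 * M ^+ 2.
    by rewrite /t; field; rewrite gt_eqF.
  rewrite zz (scalerBr (2 * t)%:C) (scalerBr (t ^+ 2)%:C).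
  rewrite (scalerA (2 * t)%:C e%:C) (scalerA (t ^+ 2)%:C (M ^+ 2)%:C) -!rmorphM.
  rewrite scalarD scalarB scale1r -(addrA 1) -(addrA 1 (- _)) subrDD opprD opprK.
  by rewrite addrACA [- _ + _ *: impart T]addrC.
apply: posD; first by apply: posZ => //; rewrite mulr_ge0.
apply: posZ; first exact: sqr_ge0.
apply: cnorm_le_pos; first exact: selfadjoint_starM.
by rewrite cnorm_starM lerXn2r ?nnegrE ?cnorm_ge0 // ltW.
Qed.

Lemma sqrt_one_sub_lt (q : R) : 0 < q -> q <= 1 ->
  Num.sqrt (1 - q ^+ 2) < 1 /\ q ^+ 2 / 2 <= 1 - Num.sqrt (1 - q ^+ 2).
Proof.
move=> q0 q1; set s := Num.sqrt _.
have s2 : s ^+ 2 = 1 - q ^+ 2 by rewrite sqr_sqrtr // subr_ge0 expr_le1 // ltW.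
have s0 : 0 <= s by exact: sqrtr_ge0.
have qq : 0 < q ^+ 2 by rewrite exprn_gt0.
by split; nra.
Qed.

(** The Neumann series inverts $cT$ for $c = -ie/M^2$, with $\|(cT)^{-1}\| \le 2M^2/e^2$;
    multiplying by $|c|$ cancels $M$. The bound depends on [e] alone, which later makes estimates
    uniform in the law. *)
Lemma above_unit T e : 0 < e -> above e T ->
  T \is a GRing.unit /\ cnorm T^-1 <= 2 / e.
Proof.
move=> e0 Te; pose M := cnorm T + e.
have eM : e <= M by rewrite lerDr cnorm_ge0.
have M0 : 0 < M by exact: lt_le_trans eM.
have TM : cnorm T <= M by rewrite lerDl ltW.
have hT := above_contraction e0 eM TM Te.
have [|s1 qs] := @sqrt_one_sub_lt (e / M) (divr_gt0 e0 M0).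
  by rewrite ler_pdivrMr // mul1r.
have [TU TV _] := neumann hT s1; move: TU TV; rewrite subKr.
set c := - 'i * _ => TU TV.
have c0 : c != 0.
  rewrite /c mulf_neq0 ?oppr_eq0 ?neq0Ci // (inj_eq (@complexI R)).
  by rewrite gt_eqF // divr_gt0 // exprn_gt0.
have cU : c \is a GRing.unit by rewrite unitfE.
have {}TU : T \is a GRing.unit by rewrite -(scaler_unit _ cU).
split=> //; have -> : T^-1 = c *: (c *: T)^-1.
  by rewrite invrZ // scalerA mulfV // scale1r.
rewrite cnormZ Normc.normcM normcN normc_i mul1r normc_real gtr0_norm; last first.
  by rewrite divr_gt0 // exprn_gt0.
apply: le_trans (ler_wpM2l _ TV) _; first by rewrite divr_ge0 ?sqr_ge0 // ltW.
rewrite ler_pdivrMr ?subr_gt0 //.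
apply: le_trans (ler_wpM2l _ qs); last by rewrite divr_ge0 // ltW.
by rewrite le_eqVlt; apply/orP; left; apply/eqP; field; rewrite !gt_eqF.
Qed.

(** With $k = Im\,b$ and $M = \|k^{-1}\|$, conjugating $M - k^{-1} \ge 0$ by the root of $k$ gives
    $Mk \ge 1$. *)
Lemma upper_half_above b : upper_half b -> exists2 e, 0 < e & above e b.
Proof.
move=> [/positiveP pk kU]; set k := impart b in pk kU *.
have kVU : k^-1 \is a GRing.unit by rewrite unitrV.
pose M := cnorm k^-1; have M0 : 0 < M by exact: cnorm_unit_gt0.
exists M^-1; first by rewrite invr_gt0.
have sk : selfadjoint k by case: pk.
have [r [[sr _] r2 rc]] := pos_sqrt pk.
have rkV : r * k^-1 = k^-1 * r by apply: commrV; exact: rc.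
have pM : pos (M%:C%:A - k^-1).
  by apply: cnorm_le_pos => //; rewrite /selfadjoint starV // sk.
have := posZ (ltW (_ : 0 < M^-1)) (pos_conj r pM); rewrite invr_gt0 => /(_ M0).
rewrite /above -/k sr mulrBr mulrBl mulr_algr -scalerAl -expr2 r2 rkV -mulrA -expr2 r2.
by rewrite mulVr // scalerBr scalerA -rmorphM mulVf ?gt_eqF // scale1r.
Qed.

Lemma above_upper_half b e : 0 < e -> above e b -> upper_half b.
Proof.
move=> e0 be; have pe : pos (e%:C%:A : A) by apply: pos_scalar; exact: ltW.
split; first by apply/positiveP; rewrite -(subrK e%:C%:A (impart b)); exact: posD.
(* Invertibility of $Im\,b$ comes from [above_unit] applied to $i\,Im\,b$, whose imaginary part is
   $Im\,b$. *)
have ib : impart ('i *: impart b) = impart b.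
  apply: impart_eq; rewrite starZ conjCi selfadjoint_impart scaleNr opprK.
  by rewrite -mulr2n -scaler_nat scalerA.
have iU : ('i : R[i]) \is a GRing.unit by rewrite unitfE neq0Ci.
rewrite -(scaler_unit _ iU); apply: (proj1 (above_unit e0 _)).
by rewrite /above ib.
Qed.

(** With $S = T^{-1}$, one has $Im(-S) = S^* (Im\,T) S \ge e S^* S \ge e/\|T\|^2$. *)
Lemma above_opp_inv T e : 0 < e -> above e T -> exists2 e', 0 < e' & above e' (- T^-1).
Proof.
move=> e0 Te; have [TU _] := above_unit e0 Te.
pose M := cnorm T; have M0 : 0 < M by exact: cnorm_unit_gt0.
have M2 : 0 < M ^+ 2 by rewrite exprn_gt0.
exists (e / M ^+ 2); first exact: divr_gt0.
have RT : star T^-1 * star T = 1 by rewrite -starM divrr // star1.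
have im : impart (- T^-1) = star T^-1 * impart T * T^-1.
  apply: impart_eq; rewrite scalerAl scalerAr -impartE mulrBr mulrBl.
  by rewrite RT mul1r -mulrA divrr // mulr1 starN opprK addrC.
have pR : pos (star T^-1 * T^-1 - (M ^- 2)%:C%:A).
  have := pos_conj T^-1 (cnorm_le_pos (selfadjoint_starM T) (lexx _)).
  move=> /(posZ (ltW (_ : 0 < M ^- 2))); rewrite invr_gt0 => /(_ M2).
  rewrite cnorm_starM -/M mulrBr mulrBl mulrA RT mul1r divrr // mulr_algr -scalerAl.
  by rewrite scalerBr scalerA -rmorphM mulVf ?scale1r // gt_eqF.
rewrite /above im.
have -> : star T^-1 * impart T * T^-1 - (e / M ^+ 2)%:C%:A =
  star T^-1 * (impart T - e%:C%:A) * T^-1 + e%:C *: (star T^-1 * T^-1 - (M ^- 2)%:C%:A).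
  rewrite mulrBr mulrBl mulr_algr -scalerAl scalerBr scalerA -rmorphM addrA subrK.
  by [].
by apply: posD; [exact: pos_conj|apply: posZ => //; exact: ltW].
Qed.

End UpperHalf.

(** * Realizations of a law *)

Section Realization.
Variables (R : realType) (B : cstarAlgType R) (P : ovps B).
Local Notation inj := (ovps_inj P).
Local Notation E := (ovps_E P).
Implicit Types (a c : P) (b : B).

Lemma inj_scalar (z : R[i]) : inj z%:A = z%:A.
Proof. by rewrite linearZ rmorph1. Qed.

Lemma inj_pos b : pos b -> pos (inj b).
Proof.
move=> /pos_sqrt[r [[sr _] <- _]]; rewrite rmorphXn; apply: pos_sqr.
by rewrite /selfadjoint -ovps_inj_star sr.
Qed.

(** The inclusion preserves the positivity of $\|b\|^2 - b^*b$. *)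
Lemma inj_cnorm b : cnorm (inj b) <= cnorm b.
Proof.
rewrite -ler_sqr ?nnegrE ?cnorm_ge0 // -cnorm_starM -ovps_inj_star -rmorphM.
apply: pos_cnorm_le; first exact: sqr_ge0.
  exact/inj_pos/pos_starM.
rewrite -inj_scalar -rmorphB; apply: inj_pos; apply: cnorm_le_pos.
  exact: selfadjoint_starM.
by rewrite cnorm_starM.
Qed.

Lemma inj_impart b : impart (inj b) = inj (impart b).
Proof. by rewrite /impart linearZ /= rmorphB -ovps_inj_star. Qed.

Lemma above_inj_sub e b (x : P) : selfadjoint x -> above e b -> above e (inj b - x).
Proof.
move=> sx be; rewrite /above impartD (@impart_selfadjoint _ _ (- x)); last by rewrite /selfadjoint starN sx.
by rewrite addr0 inj_impart -inj_scalar -rmorphB; exact: inj_pos.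
Qed.

Lemma E_scalar (z : R[i]) : E z%:A = z%:A.
Proof. by rewrite -inj_scalar ovps_Einj. Qed.

Lemma E_injl b a : E (inj b * a) = b * E a.
Proof. by rewrite -[inj b * a]mulr1 -(rmorph1 inj) ovps_bimodule mulr1. Qed.

Lemma E_pos a : pos a -> pos (E a).
Proof.
move=> /pos_sqrt[r [[sr _] <- _]].
have [C /matrixP/(_ ord0 ord0)] := @ovps_cp _ _ P 1 (const_mx r).
rewrite !mxE !big_ord1 !mxE sr -expr2 => ->; exact: pos_starM.
Qed.

(** $\|a\| + a$ is positive, so its image is selfadjoint; the scalar is then subtracted. *)
Lemma E_selfadjoint a : selfadjoint a -> selfadjoint (E a).
Proof.
move=> sa; have [s _] : pos (E ((cnorm a)%:C%:A - - a)).
  by apply: E_pos; apply: cnorm_le_pos; rewrite ?cnormN // /selfadjoint starN sa.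
have := selfadjointB s (selfadjoint_scalar B (cnorm a)).
by rewrite linearB E_scalar linearN opprK addrAC subrr add0r.
Qed.

Lemma selfadjoint_Re (A : cstarAlgType R) (a : A) : selfadjoint (a + star a).
Proof. by rewrite /selfadjoint starD starK addrC. Qed.

Lemma selfadjoint_Im (A : cstarAlgType R) (a : A) : selfadjoint ('i *: (a - star a)).
Proof. by rewrite /selfadjoint starZ conjCi starB starK scaleNr -scalerN opprB. Qed.

Lemma double_cartesian (A : cstarAlgType R) (a : A) :
  2%:C *: a = (a + star a) - 'i *: ('i *: (a - star a)).
Proof.
by rewrite scalerA -expr2 sqrCi scaleN1r opprK addrACA subrr addr0 rmorph_nat scaler_nat mulr2n.
Qed.

Lemma E_star a : E (star a) = star (E a).
Proof.
have := E_selfadjoint (selfadjoint_Im a); have := E_selfadjoint (selfadjoint_Re a).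
rewrite /selfadjoint linearD linearZ linearB starD starZ conjCi starB scaleNr -scalerN => h1 /=.
move/(scalerI (neq0Ci _)); rewrite opprB => h2.
have := congr2 +%R h1 h2; rewrite [star (E (star a)) - _]addrC addrACA subrr add0r.
rewrite [RHS]addrACA subrr addr0.
move/eqP; rewrite -subr_eq0 opprD addrACA -mulr2n -scaler_nat scaler_eq0 pnatr_eq0 /=.
by rewrite subr_eq0 => /eqP <-; rewrite starK.
Qed.

(** [E] preserves $0 \le \|a\| - a \le 2\|a\|$, and the triangle inequality gives 3. A crude
    constant suffices, as long as it is the same for all realizations. *)
Lemma E_cnorm_selfadjoint a : selfadjoint a -> cnorm (E a) <= 3 * cnorm a.
Proof.
move=> sa; set l := cnorm a; have l0 : 0 <= l by exact: cnorm_ge0.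
have p1 : pos (l%:C%:A - a) by exact: cnorm_le_pos.
have p2 : pos (l%:C%:A - - a).
  by apply: cnorm_le_pos; rewrite ?cnormN // /selfadjoint starN sa.
have : cnorm (E (l%:C%:A - a)) <= 2 * l.
  apply: pos_cnorm_le; [by rewrite mulr_ge0|exact: E_pos|].
  rewrite -E_scalar -linearB; apply: E_pos.
  by rewrite mulr_natl mulr2n scalarD opprB [a - _]addrC addrA addrK -[X in _ + X]opprK.
rewrite linearB E_scalar => le2.
have := cnormB_le (l%:C%:A : B) (l%:C%:A - E a).
rewrite subKr cnorm_scalar ger0_norm //; lra.
Qed.

Lemma E_cnorm a : cnorm (E a) <= 6 * cnorm a.
Proof.
have h1 : cnorm (a + star a) <= 2 * cnorm a.
  by apply: le_trans (cnormD_le _ _) _; rewrite cnorm_star; lra.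
have h2 : cnorm ('i *: (a - star a)) <= 2 * cnorm a.
  by rewrite cnormZ normc_i mul1r; apply: le_trans (cnormB_le _ _) _; rewrite cnorm_star; lra.
have e1 := E_cnorm_selfadjoint (selfadjoint_Re a).
have e2 := E_cnorm_selfadjoint (selfadjoint_Im a).
have : cnorm (E (2%:C *: a)) <= cnorm (E (a + star a)) + cnorm (E ('i *: (a - star a))).
  rewrite double_cartesian linearB; set v := 'i *: (a - star a).
  have -> : E ('i *: v) = 'i *: E v by rewrite linearZ.
  by apply: le_trans (cnormB_le _ _) _; rewrite cnormZ normc_i mul1r.
rewrite linearZ cnormZr ger0_norm //; lra.
Qed.

Lemma E_lip a c : cnorm (E a - E c) <= 6 * cnorm (a - c).
Proof. by rewrite -linearB; exact: E_cnorm. Qed.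

End Realization.

(** * Simultaneous polynomial approximation in two realizations *)

Section Approximation.
Variables (R : realType) (B : cstarAlgType R) (P Q : ovps B) (x : P) (y : Q).
Implicit Types (a c : P) (b d : Q).

(* The same polynomials have to approximate [a] and [b]: two elements obtained
   from realizations [x] and [y] of one law by the same limit of polynomials
   have the same expectation. *)
Definition coapprox a b := forall e : R, 0 < e -> exists q : ncpoly B,
  cnorm (a - nceval (ovps_inj P) x q) < e /\ cnorm (b - nceval (ovps_inj Q) y q) < e.

Lemma coapprox_eval q : coapprox (nceval (ovps_inj P) x q) (nceval (ovps_inj Q) y q).
Proof. by move=> e e0; exists q; rewrite !subrr !cnorm0. Qed.

Lemma coapprox_inj (u : B) : coapprox (ovps_inj P u) (ovps_inj Q u).
Proof. by have := coapprox_eval (nccst u); rewrite !nceval_cst. Qed.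

Lemma coapproxX : coapprox x y.
Proof. by have := coapprox_eval (ncX B); rewrite !nceval_X. Qed.

Lemma coapproxD a b c d : coapprox a b -> coapprox c d -> coapprox (a + c) (b + d).
Proof.
move=> ab cd e e0; have e20 : 0 < e / 2 by rewrite divr_gt0.
have [p [ap bp]] := ab _ e20; have [q [cq dq]] := cd _ e20; exists (p + q).
rewrite !ncevalD !opprD (addrACA a) (addrACA b).
by split; apply: le_lt_trans (cnormD_le _ _) _; rewrite [ltRHS]splitr ltrD.
Qed.

Lemma cnorm_mulB_lt (A : cstarAlgType R) (a c p q : A) (K e : R) :
  0 < e -> cnorm a + cnorm c + 1 <= K ->
  cnorm (a - p) < e / (K + e) -> cnorm (c - q) < e / (K + e) ->
  cnorm (a * c - p * q) < e.
Proof.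
(* This tolerance satisfies both $d \le 1$ and $dK < e$. *)
move=> e0 hK ap cq; set d := e / (K + e) in ap cq.
have [a0 c0] := (cnorm_ge0 a, cnorm_ge0 c).
have K0 : 0 < K by lra.
have d0 : 0 < d by rewrite divr_gt0 // addr_gt0.
have d1 : d <= 1 by rewrite ler_pdivrMr ?addr_gt0 // mul1r lerDr ltW.
have p1 : cnorm p <= cnorm a + 1.
  rewrite -(subKr a p); apply: le_trans (cnormB_le _ _) _; rewrite lerD2l.
  by rewrite ltW // (lt_le_trans ap).
have dK : d * K < e.
  rewrite /d mulrAC ltr_pdivrMr ?addr_gt0 // ltr_pM2l // ltrDl //.
rewrite -(subrKA (p * c)) -mulrBl -mulrBr.
apply: le_lt_trans (cnormD_le _ _) (le_lt_trans _ dK).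
apply: le_trans (_ : d * cnorm c + (cnorm a + 1) * d <= _); last first.
  have := ler_wpM2l (ltW d0) hK; nra.
apply: lerD; apply: le_trans (cnormM_le _ _) _.
  by apply: ler_wpM2r => //; exact: ltW.
by apply: ler_pM => //; rewrite ?cnorm_ge0 // ltW.
Qed.

Lemma coapproxM a b c d : coapprox a b -> coapprox c d -> coapprox (a * c) (b * d).
Proof.
move=> ab cd e e0.
pose K := Num.max (cnorm a + cnorm c + 1) (cnorm b + cnorm d + 1).
have K1 : cnorm a + cnorm c + 1 <= K by rewrite le_max lexx.
have K2 : cnorm b + cnorm d + 1 <= K by rewrite le_max lexx orbT.
have K0 : 0 < K by apply: lt_le_trans K1; rewrite ltr_wpDl // addr_ge0 // cnorm_ge0.
have d0 : 0 < e / (K + e) by rewrite divr_gt0 // addr_gt0.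
have [p [ap bp]] := ab _ d0; have [q [cq dq]] := cd _ d0; exists (p * q).
by rewrite !ncevalM; split; apply: cnorm_mulB_lt; eauto.
Qed.

Lemma coapprox_scalar (z : R[i]) : coapprox z%:A z%:A.
Proof. by rewrite -(inj_scalar P) -(inj_scalar Q); exact: coapprox_inj. Qed.

Lemma coapproxZ (z : R[i]) a b : coapprox a b -> coapprox (z *: a) (z *: b).
Proof. by move=> ab; rewrite -[z *: a]mulr_algl -[z *: b]mulr_algl; apply: coapproxM => //; exact: coapprox_scalar. Qed.

Lemma coapprox_lim (u : nat -> P) (v : nat -> Q) a b :
  (forall n, coapprox (u n) (v n)) -> norm_cvg \oo u a -> norm_cvg \oo v b ->
  coapprox a b.
Proof.
move=> uv /norm_cvgP ua /norm_cvgP vb e e0; have e20 : 0 < e / 2 by rewrite divr_gt0.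
have [n [una vnb]] := filter_ex (filterI (ua _ e20) (vb _ e20)).
have [q [uq vq]] := uv n _ e20; exists q.
by split; rewrite [ltRHS]splitr; [apply: le_lt_trans (cnorm_dist _ (u n) _) _|
  apply: le_lt_trans (cnorm_dist _ (v n) _) _]; rewrite cnormBC ltrD // cnormBC.
Qed.

Lemma coapprox_inv (e : R) a b : 0 < e -> above e a -> above e b ->
  coapprox a b -> coapprox a^-1 b^-1.
Proof.
move=> e0 ea eb ab.
have [[aU _] [bU _]] := (above_unit e0 ea, above_unit e0 eb).
(* A common bound gives the same scalar [z] in both Neumann iterations, so the iterates are the same
   polynomials in [a] and in [b]. *)
pose M := Num.max e (Num.max (cnorm a) (cnorm b)).
have eM : e <= M by rewrite le_max lexx.
have aM : cnorm a <= M by rewrite !le_max lexx orbT.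
have bM : cnorm b <= M by rewrite !le_max lexx !orbT.
have M0 : 0 < M by exact: lt_le_trans eM.
have [|s1 _] := @sqrt_one_sub_lt _ (e / M) (divr_gt0 e0 M0).
  by rewrite ler_pdivrMr // mul1r.
have := above_contraction e0 eM aM ea; have := above_contraction e0 eM bM eb.
set z := - 'i * _ => hb ha.
have z0 : z != 0.
  rewrite mulf_neq0 ?oppr_eq0 ?neq0Ci // (inj_eq (@complexI R)).
  by rewrite gt_eqF // divr_gt0 // exprn_gt0.
have zU : z \is a GRing.unit by rewrite unitfE.
have [_ _ ca] := neumann ha s1; have [_ _ cb] := neumann hb s1.
rewrite !subKr in ca cb.
have inv (A : cstarAlgType R) (c : A) : c \is a GRing.unit -> c^-1 = z *: (z *: c)^-1.
  by move=> cU; rewrite invrZ // scalerA mulfV // scale1r.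
rewrite inv // (inv _ b) //; apply: coapproxZ; apply: coapprox_lim ca cb => n.
have one : coapprox 1 1 by have := coapprox_scalar 1; rewrite !scale1r.
elim: n => [|n IHn] /=; first by have := coapprox_scalar 0; rewrite !scale0r.
apply: coapproxD => //; apply: coapproxM => //; apply: coapproxD => //.
by rewrite -!scaleNr; exact: coapproxZ.
Qed.

Lemma coapprox_E (mu : sigma0 B) a b : has_law x mu -> has_law y mu ->
  coapprox a b -> ovps_E P a = ovps_E Q b.
Proof.
move=> xmu ymu ab; apply/subr0_eq/cnorm0_eq0/eqP; rewrite eq_le cnorm_ge0 andbT.
apply/ler_addgt0Pl => e e0; rewrite addr0.
(* Two errors, each multiplied by the bound 6 of [E], add up to [e]. *)
have e12 : 0 < e / 12 by rewrite divr_gt0.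
have [q [aq bq]] := ab _ e12.
apply: le_trans (cnorm_dist _ (mu q) _) _; rewrite {1}xmu ymu.
rewrite [X in _ + X]cnormBC.
apply: le_trans (lerD (E_lip _ _) (E_lip _ _)) _; lra.
Qed.

End Approximation.

(** * Cauchy transforms computed in an arbitrary realization *)

Section Cauchy.
Variables (R : realType) (B : cstarAlgType R).

Lemma resolvent_unit (P : ovps B) (x : P) b : selfadjoint x -> upper_half b ->
  ovps_inj P b - x \is a GRing.unit.
Proof.
move=> sx /upper_half_above[e e0 be].
exact: (proj1 (above_unit e0 (above_inj_sub sx be))).
Qed.

Lemma coapprox_resolvent (P Q : ovps B) (x : P) (y : Q) b :
  selfadjoint x -> selfadjoint y -> upper_half b ->
  coapprox x y (ovps_inj P b - x)^-1 (ovps_inj Q b - y)^-1.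
Proof.
move=> sx sy /upper_half_above[e e0 be].
apply: (coapprox_inv e0); try exact: above_inj_sub.
apply: coapproxD; first exact: coapprox_inj.
by rewrite -scaleN1r -(scaleN1r y); apply: coapproxZ; exact: coapproxX.
Qed.

(** [cauchy] picks some realization by choice; co-approximation of the two resolvents shows that the
    given one yields the same value. *)
Lemma cauchyE (P : ovps B) (x : P) (mu : sigma0 B) b :
  selfadjoint x -> has_law x mu -> upper_half b ->
  cauchy mu b = ovps_E P (ovps_inj P b - x)^-1.
Proof.
move=> sx xmu hb; rewrite /cauchy /cauchyn; case: xgetP => [g _|].
  move=> [Q [y [r [sy ymu [yr ry] ->]]]]; rewrite mxE.
  have -> : r ord0 ord0 = (ovps_inj Q b - y)^-1.
    have yU := resolvent_unit sy hb.
    apply: (mulrI yU); rewrite divrr //.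
    by move/matrixP/(_ ord0 ord0): yr; rewrite !mxE big_ord1 !mxE.
  by apply: (coapprox_E ymu xmu); exact: coapprox_resolvent.
(* The default value of [xget] is excluded: the given realization is a witness. *)
have xU := resolvent_unit sx hb.
move/(_ (map_mx (ovps_E P) ((ovps_inj P b - x)^-1)%:M)); case.
exists P, x, ((ovps_inj P b - x)^-1)%:M; split=> //.
rewrite map_scalar_mx -raddfB /is_mxinverse -!scalar_mxM.
by rewrite divrr // mulVr.
Qed.

End Cauchy.

(** Words are functions on the naturals, as in the independence relations; the conditional appends
    the letter [c] to a word of length [n]. *)
Lemma prod_rcons (A : pzRingType) (f : nat -> A) (c : A) n :
  \prod_(0 <= k < n.+1) (if (k < n)%N then f k else c) = (\prod_(0 <= k < n) f k) * c.
Proof.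
rewrite big_nat_recr //= ltnn; congr (_ * _).
by apply: eq_big_nat => k /andP[_ ->].
Qed.

(** * Reciprocal Cauchy transforms and approximation of resolvents *)

Section Reciprocal.
Variables (R : realType) (B : cstarAlgType R).

Lemma above_E (P : ovps B) (e : R) (a : P) : above e a -> above e (ovps_E P a).
Proof.
rewrite /above => ea; have -> : impart (ovps_E P a) = ovps_E P (impart a).
  by rewrite /impart -E_star -linearB linearZ.
by rewrite -(E_scalar P) -linearB; exact: E_pos.
Qed.

Lemma cauchy_above (P : ovps B) (x : P) (mu : sigma0 B) b :
  selfadjoint x -> has_law x mu -> upper_half b ->
  exists2 e : R, 0 < e & above e (- cauchy mu b).
Proof.
move=> sx xmu hb; have /upper_half_above[e e0 be] := hb.
have [d d0 hd] := above_opp_inv e0 (above_inj_sub sx be); exists d => //.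
by rewrite (cauchyE sx xmu hb) -linearN; exact: above_E.
Qed.

Lemma cauchy_unit (P : ovps B) (x : P) (mu : sigma0 B) b :
  selfadjoint x -> has_law x mu -> upper_half b -> cauchy mu b \is a GRing.unit.
Proof.
move=> sx xmu /(cauchy_above sx xmu)[e e0 /(above_unit e0)[]].
by rewrite unitrN.
Qed.

(** [above_opp_inv] is applied to $-G$, whose negated inverse is $F$. Hence $G_\mu$ can be evaluated
    at $F_\nu(b)$. *)
Lemma rcauchy_upper_half (P : ovps B) (x : P) (mu : sigma0 B) b :
  selfadjoint x -> has_law x mu -> upper_half b -> upper_half (rcauchy mu b).
Proof.
move=> sx xmu /(cauchy_above sx xmu)[e e0 /(above_opp_inv e0)[d d0]].
by rewrite invrN opprK; exact: above_upper_half.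
Qed.

Lemma resolvent_seq (P : ovps B) (x : P) b : selfadjoint x -> upper_half b ->
  exists q : nat -> ncpoly B,
    norm_cvg \oo (fun n => nceval (ovps_inj P) x (q n)) (ovps_inj P b - x)^-1.
Proof.
move=> sx hb; have app := coapprox_resolvent sx sx hb.
have /choice[q hq] n : exists q : ncpoly B,
    cnorm ((ovps_inj P b - x)^-1 - nceval (ovps_inj P) x q) < n.+1%:R^-1.
  by have [|q []] := app n.+1%:R^-1; [rewrite invr_gt0|exists q].
exists q; apply: (norm_cvg_dom (g := @harmonic R)); last exact: cvg_harmonic.
by near=> n; rewrite cnormBC ltW // hq.
Unshelve. all: by end_near. Qed.

Lemma norm_cvg_E (P : ovps B) (u : nat -> P) a :
  norm_cvg \oo u a -> norm_cvg \oo (fun n => ovps_E P (u n)) (ovps_E P a).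
Proof. by apply: norm_cvg_lip; exact: E_lip. Qed.

End Reciprocal.

(** * Alternating words and independence *)

Section Words.
Variables (R : realType) (B : cstarAlgType R) (P : ovps B) (x y : P).
Local Notation inj := (ovps_inj P).
Local Notation E := (ovps_E P).
Local Notation ev := (nceval inj).
Local Notation S := (gen_pair x y).
Implicit Types (a u v w : P) (i : bool) (q : ncpoly B).

Lemma gen_alg_mul_eval z a q : gen_alg z a -> gen_alg z (a * ev z q).
Proof.
elim/ncpolyW: q => q; rewrite nceval_pi.
elim: q a => [b||p IHp q IHq|p IHp q IHq] a za /=.
- exact: gen_alg_right.
- by apply: gen_alg_mul => //; exact: gen_alg_gen.
- by rewrite mulrDr; apply: gen_alg_add; [exact: IHp|exact: IHq].
- by rewrite mulrA; apply: IHq; exact: IHp.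
Qed.

Lemma gen_pairM i a c : S i a -> S i c -> S i (a * c).
Proof. by case: i; exact: gen_alg_mul. Qed.

Lemma gen_pair_left i b a : S i a -> S i (inj b * a).
Proof. by case: i; exact: gen_alg_left. Qed.

Lemma gen_pair_right i b a : S i a -> S i (a * inj b).
Proof. by case: i; exact: gen_alg_right. Qed.

Definition letter i : P := if i then y else x.

Lemma gen_pair_letter i : S i (letter i).
Proof. by case: i; exact: gen_alg_gen. Qed.

(** Sums of alternating words whose first letter has index [i], built from the left so that
    independence can be proved by induction on the tail. *)
Inductive altsum : bool -> P -> Prop :=
| altsum_letter i a : S i a -> altsum i a
| altsum_cons i a w : S i a -> altsum (~~ i) w -> altsum i (a * w)
| altsum_add i u v : altsum i u -> altsum i v -> altsum i (u + v).

Lemma altsum_left i b w : altsum i w -> altsum i (inj b * w).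
Proof.
elim=> [{}i a ia|{}i a {}w ia iw _|{}i u v _ bu _ bv].
- by apply: altsum_letter; exact: gen_pair_left.
- by rewrite mulrA; apply: altsum_cons => //; exact: gen_pair_left.
- by rewrite mulrDr; exact: altsum_add.
Qed.

Lemma altsum_letter_mul i w : altsum i w -> altsum i (letter i * w).
Proof.
elim=> [{}i a ia|{}i a {}w ia iw _|{}i u v _ bu _ bv].
- by apply: altsum_letter; apply: gen_pairM => //; exact: gen_pair_letter.
- by rewrite mulrA; apply: altsum_cons => //; apply: gen_pairM => //; exact: gen_pair_letter.
- by rewrite mulrDr; exact: altsum_add.
Qed.

Lemma altsum0 i : altsum i 0.
Proof.
rewrite -(mul0r (letter i)) -(rmorph0 inj).
by apply: altsum_letter; apply: gen_pair_left; exact: gen_pair_letter.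
Qed.

(** Elements of the algebra generated over [B] by [x] and [y], sorted into a constant and words by
    the index of their first letter. *)
Definition decomposed w := exists b (u : bool -> P),
  (forall i, altsum i (u i)) /\ w = inj b + (u false + u true).

(** A letter absorbs the constant, merges with words of its own index and prolongs the others. *)
Lemma letter_mul_decomposed i w : decomposed w -> altsum i (letter i * w).
Proof.
case=> b [u [hu ->]]; rewrite !mulrDr; apply: altsum_add.
  by apply: altsum_letter; apply: gen_pair_right; exact: gen_pair_letter.
have h j : altsum i (letter i * u j).
  have [->|ij] := eqVneq j i; first exact: altsum_letter_mul.
  apply: altsum_cons; first exact: gen_pair_letter.
  by rewrite (_ : ~~ i = j) //; case: i j ij => [] [].
by apply: altsum_add.
Qed.

Lemma decomposedD v w : decomposed v -> decomposed w -> decomposed (v + w).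
Proof.
case=> b [u [hu ->]] [c [t [ht ->]]]; exists (b + c), (fun i => u i + t i).
split=> [i|]; first exact: altsum_add.
by rewrite rmorphD [LHS]addrACA [u false + _ + _]addrACA.
Qed.

Lemma decomposed_altsum i w : altsum i w -> decomposed w.
Proof.
move=> iw; exists 0, (fun j => if j == i then w else 0); split=> [j|].
  by case: eqP => [->|_] //; exact: altsum0.
by rewrite rmorph0 add0r; case: {iw} i => /=; rewrite ?addr0 ?add0r.
Qed.

Lemma eval_mul_decomposed q w : decomposed w -> decomposed (ev (x + y) q * w).
Proof.
elim/ncpolyW: q => q; rewrite nceval_pi.
elim: q w => [b||p IHp q IHq|p IHp q IHq] w dw /=.
- case: dw => c [u [hu ->]]; exists (b * c), (fun i => inj b * u i).
  by split=> [i|]; [exact: altsum_left|rewrite rmorphM !mulrDr].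
- rewrite mulrDl; apply: decomposedD.
    by apply: (@decomposed_altsum false); exact: (@letter_mul_decomposed false).
  by apply: (@decomposed_altsum true); exact: (@letter_mul_decomposed true).
- by rewrite mulrDl; apply: decomposedD; [exact: IHp|exact: IHq].
- by rewrite -mulrA; apply: IHp; exact: IHq.
Qed.

(** The form in which $xr$ and $yr$, with $r$ the resolvent of $x + y$, are approximated. *)
Lemma altsum_letter_eval i q : altsum i (letter i * ev (x + y) q).
Proof.
apply: letter_mul_decomposed; rewrite -[ev _ _]mulr1; apply: eval_mul_decomposed.
exists 1, (fun=> 0); split=> [i'|]; first exact: altsum0.
by rewrite rmorph1 !addr0.
Qed.

(** The prefix [a] makes the induction work: the leading letter of [w] is moved to the end of the
    prefix, until independence applies to a single word. *)
Lemma boolean_prefix i w : boolean_independent S -> altsum i w ->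
  forall n (j : nat -> bool) (a : nat -> P),
  (forall k, (k < n)%N -> S (j k) (a k)) ->
  (forall k, (k.+1 < n)%N -> j k != j k.+1) ->
  ((0 < n)%N -> j n.-1 = ~~ i) ->
  E ((\prod_(0 <= k < n) a k) * w) = (\prod_(0 <= k < n) E (a k)) * E w.
Proof.
move=> ind; elim=> [{}i c ic|{}i c {}w ic _ IH|{}i u v _ IHu _ IHv] n j a Sa alt jn.
- rewrite -!prod_rcons (@ind n.+1 (fun k => if (k < n)%N then j k else i)).
  + by apply: eq_big_nat => k _; case: ifP.
  + by move=> k; rewrite ltnS => kn; case: ltnP => [/Sa|].
  (* The only new adjacency is that of the last letter of the prefix with [c]. *)
  + move=> k; rewrite ltnS => kn; rewrite kn; case: ltnP => [/alt //|nk].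
    have kE : k = n.-1 by case: n {Sa alt jn} kn nk => // n; rewrite ltnS => h1 h2; apply/eqP; rewrite eqn_leq h1 -ltnS.
    by rewrite kE jn ?(leq_ltn_trans _ kn) //; case: (i).
(* The one-letter prefix [c] factors [E (c * w)] on the right-hand side. *)
- have IH1 := IH 1%N (fun=> i) (fun=> c).
  rewrite !big_nat1 in IH1.
  rewrite IH1 // ?negbK //.
  rewrite !mulrA -prod_rcons -[in RHS]prod_rcons.
  rewrite (IH n.+1 (fun k => if (k < n)%N then j k else i)).
  + by congr (_ * _); apply: eq_big_nat => k _; case: ifP.
  + by move=> k; rewrite ltnS => kn; case: ltnP => [/Sa|].
  + move=> k; rewrite ltnS => kn; rewrite kn; case: ltnP => [/alt //|nk].
    have kE : k = n.-1 by case: n {Sa alt jn} kn nk => // n; rewrite ltnS => h1 h2; apply/eqP; rewrite eqn_leq h1 -ltnS.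
    by rewrite kE jn ?(leq_ltn_trans _ kn) //; case: (i).
  + by move=> _ /=; rewrite ltnn negbK.
- by rewrite mulrDr !linearD (IHu n j a) // (IHv n j a) // mulrDr.
Qed.

Lemma boolean_mul i a w : boolean_independent S -> S (~~ i) a -> altsum i w ->
  E (a * w) = E a * E w.
Proof.
move=> ind xa tw; have := boolean_prefix ind tw (n := 1) (j := fun=> ~~ i) (a := fun=> a).
by rewrite !big_nat1; apply.
Qed.

(** Letters are moved as in [boolean_prefix]. Position [m] is a peak; if it ends the prefix, its
    right neighbour is the first letter of [w], whence the last hypothesis. *)
Lemma monotone_prefix i w : monotone_independent S -> altsum i w ->
  forall n (j : nat -> bool) (a : nat -> P) m,
  (forall k, (k < n)%N -> S (j k) (a k)) -> (m < n)%N -> 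
  ((0 < m)%N -> (j m.-1 < j m)%O) ->
  ((m.+1 < n)%N -> (j m.+1 < j m)%O) -> (m.+1 = n -> (i < j m)%O) ->
  E ((\prod_(0 <= k < n) a k) * w) =
  E ((\prod_(0 <= k < n) (if k == m then inj (E (a k)) else a k)) * w).
Proof.
move=> ind; elim=> [{}i c ic|{}i c {}w ic _ IH|{}i u v _ IHu _ IHv] n j a m Sa mn jm jm1 mi.
- rewrite -!prod_rcons (@ind n.+1 (fun k => if (k < n)%N then j k else i) _ m).
  + congr (E _); apply: eq_big_nat => k _.
    by case: ifP => [|/negbT]; case: eqP => // ->; rewrite mn.
  + by move=> k; rewrite ltnS => kn; case: ltnP => [/Sa|].
  + by rewrite ltnW.
  + by move=> m0; rewrite mn (leq_ltn_trans (leq_pred _) mn); exact: jm.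
  + by rewrite mn => _; case: ltnP => [/jm1//|nm]; apply: mi; apply/eqP; rewrite eqn_leq mn.
- rewrite !mulrA -!(prod_rcons _ c) (IH n.+1 (fun k => if (k < n)%N then j k else i)
    (fun k => if (k < n)%N then a k else c) m).
  + congr (E (_ * _)); apply: eq_big_nat => k _.
    by case: ifP => [|/negbT]; case: eqP => // ->; rewrite mn.
  + by move=> k; rewrite ltnS => kn; case: ltnP => [/Sa|].
  + by rewrite ltnW.
  + by move=> m0; rewrite mn (leq_ltn_trans (leq_pred _) mn); exact: jm.
  + by rewrite mn => _; case: ltnP => [/jm1//|nm]; apply: mi; apply/eqP; rewrite eqn_leq mn.
  (* Position [m] is never the last one of the extended prefix. *)
  + by case=> mE; rewrite mE ltnn in mn.
- by rewrite !mulrDr !linearD (IHu n j a m) // (IHv n j a m).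
Qed.

(** The factor [c] is a peak, bordered by letters of [x] or by an end of the word. The case [a = 1]
    is the one where [c] comes first. *)
Lemma monotone_mul a c q : monotone_independent S -> a = 1 \/ gen_alg x a ->
  gen_alg y c ->
  E (a * c * (1 + x * ev (x + y) q)) = E (a * inj (E c) * (1 + x * ev (x + y) q)).
Proof.
move=> ind ha yc; rewrite !mulrDr !mulr1 !linearD.
have xw : altsum false (x * ev (x + y) q) by exact: (@altsum_letter_eval false).
case: ha => [->|xa].
  rewrite !mul1r ovps_Einj; congr (_ + _).
  have := @monotone_prefix _ _ ind xw 1 (fun=> true) (fun=> c) 0.
  by rewrite !big_nat1 /=; apply=> // k.
have Sk k : (k < 2)%N -> S (k == 1)%N (if k == 1%N then c else a).
  by case: k => [|[|]].
congr (_ + _).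
  have := ind 2%N (fun k => k == 1%N) (fun k => if k == 1%N then c else a) 1%N Sk.
  by rewrite !big_nat_recr //= !big_nil !mul1r; apply.
have := @monotone_prefix _ _ ind xw 2 (fun k => k == 1%N) (fun k => if k == 1%N then c else a) 1.
by rewrite !big_nat_recr //= !big_nil !mul1r; apply.
Qed.

End Words.

(** * Cauchy transforms of convolutions *)

Section Convolution.
Variables (R : realType) (B : cstarAlgType R).
Implicit Types (mu nu rho : sigma0 B) (b : B).

Lemma upper_half_unit b : upper_half b -> b \is a GRing.unit.
Proof. by move=> /upper_half_above[e e0 /(above_unit e0)[]]. Qed.

Lemma mul_resolvent (P : ovps B) (z : P) b : ovps_inj P b - z \is a GRing.unit ->
  ovps_inj P b * (ovps_inj P b - z)^-1 = 1 + z * (ovps_inj P b - z)^-1.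
Proof.
by move=> zU; apply/eqP; rewrite -subr_eq -mulrBl divrr.
Qed.

Lemma resolvent_expand (P : ovps B) (z : P) b :
  b \is a GRing.unit -> ovps_inj P b - z \is a GRing.unit ->
  (ovps_inj P b - z)^-1 =
    ovps_inj P b^-1 + ovps_inj P b^-1 * (z * (ovps_inj P b - z)^-1).
Proof.
move=> bU zU; apply/esym; rewrite -[X in X + _]mulr1 -mulrDr -mul_resolvent //.
by rewrite mulrA -rmorphM mulVr // rmorph1 mul1r.
Qed.

Lemma resolvent_add (P : ovps B) (z w : P) b :
  ovps_inj P b - z \is a GRing.unit -> ovps_inj P b - (z + w) \is a GRing.unit ->
  (ovps_inj P b - (z + w))^-1 =
    (ovps_inj P b - z)^-1 * (1 + w * (ovps_inj P b - (z + w))^-1).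
Proof.
move=> zU wU; apply: (mulrI zU); rewrite mulrA divrr // mul1r.
by apply/eqP; rewrite -subr_eq -mulrBl -addrA -opprD divrr.
Qed.

Lemma boolean_resolvent (P : ovps B) (x y : P) i b :
  selfadjoint x -> selfadjoint y -> boolean_independent (gen_pair x y) ->
  upper_half b -> let r := (ovps_inj P b - (x + y))^-1 in
  ovps_E P r = ovps_E P (ovps_inj P b - letter x y i)^-1 *
    (1 + ovps_E P (letter x y (~~ i) * r)).
Proof.
move=> sx sy ind hb r; set z := letter x y i; set w := letter x y (~~ i).
have sz : selfadjoint z by rewrite /z; case: (i).
have bU := upper_half_unit hb.
have zU : ovps_inj P b - z \is a GRing.unit by exact: resolvent_unit.
have sxy : selfadjoint (x + y) by exact: selfadjointD.
have xyE : x + y = z + w by rewrite /z /w; case: (i) => //=; rewrite addrC.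
have rE : r = (ovps_inj P b - z)^-1 * (1 + w * r).
  rewrite /r xyE; apply: resolvent_add => //.
  by rewrite -xyE; exact: resolvent_unit.
set s := (ovps_inj P b - z)^-1 in rE *.
have [p hp] := resolvent_seq sz hb; have [q hq] := resolvent_seq sxy hb.
(* Both factors are limits of elements to which [boolean_mul] applies, and [E] is continuous. *)
have zsw : ovps_E P (z * s * (w * r)) = ovps_E P (z * s) * ovps_E P (w * r).
  pose u n := z * nceval (ovps_inj P) z (p n).
  pose v n := w * nceval (ovps_inj P) (x + y) (q n).
  have hu : norm_cvg \oo u (z * s) by apply: norm_cvgM hp; exact: norm_cvg_cst.
  have hv : norm_cvg \oo v (w * r) by apply: norm_cvgM hq; exact: norm_cvg_cst.
  have h1 : norm_cvg \oo (fun n => ovps_E P (u n * v n)) (ovps_E P (z * s * (w * r))).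
    by apply: norm_cvg_E; exact: norm_cvgM.
  apply: norm_cvg_unique h1 _.
  apply: norm_cvg_near (norm_cvgM (norm_cvg_E hu) (norm_cvg_E hv)).
  near=> n; apply/esym/(boolean_mul ind); last exact: altsum_letter_eval.
  rewrite negbK; have := @gen_alg_mul_eval _ _ _ z z (p n) (gen_alg_gen z).
  by rewrite /u /z; case: (i).
rewrite {1}rE mulrDr mulr1 linearD mulrDr mulr1; congr (_ + _).
(* The expansion isolates the constant $b^{-1}$ of $s$; the rest contains $zs$, to which [zsw]
   applies. *)
have -> : s = ovps_inj P b^-1 + ovps_inj P b^-1 * (z * s) by exact: resolvent_expand.
by rewrite mulrDl -[_ * (z * s) * _]mulrA !linearD !E_injl zsw ovps_Einj mulrDl mulrA.
Unshelve. all: by end_near. Qed.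

Lemma boolean_rcauchy mu nu rho b : boolean_conv mu nu rho -> upper_half b ->
  rcauchy rho b = rcauchy mu b + rcauchy nu b - b /\
  cauchy rho b = (rcauchy mu b + rcauchy nu b - b)^-1.
Proof.
case=> P [x [y [[sx sy xmu ynu] [ind xyrho]]]] hb.
have sxy : selfadjoint (x + y) by exact: selfadjointD.
have GxU := cauchy_unit sx xmu hb; have GyU := cauchy_unit sy ynu hb.
have GU := cauchy_unit sxy xyrho hb.
have hx := boolean_resolvent false sx sy ind hb.
have hy := boolean_resolvent true sx sy ind hb.
have h := congr1 (ovps_E P) (mul_resolvent (resolvent_unit sxy hb)).
move: hx hy h => /=; rewrite -(cauchyE sxy xyrho hb) -(cauchyE sx xmu hb) -(cauchyE sy ynu hb).
rewrite E_injl -(cauchyE sxy xyrho hb) mulrDl !linearD -(rmorph1 (ovps_inj P)) ovps_Einj.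
set X := ovps_E P (x * _); set Y := ovps_E P (y * _) => hx hy h.
(* From $F_\mu G = 1 + Y$, $F_\nu G = 1 + X$ and $bG = 1 + X + Y$. A one-sided inverse suffices,
   since $G$ is known to be a unit. *)
have inv : (rcauchy mu b + rcauchy nu b - b) * cauchy rho b = 1.
  rewrite mulrBl h mulrDl {1}hx hy !mulrA !mulVr // !mul1r.
  by rewrite -(addrA 1 Y) subrDD [X + Y]addrC subrDD addrK.
have E : rcauchy rho b = rcauchy mu b + rcauchy nu b - b.
  by apply: (mulIr GU); rewrite inv mulVr.
by split=> //; rewrite -E /rcauchy invrK.
Qed.

Lemma monotone_cauchy mu nu rho b : monotone_conv mu nu rho -> upper_half b ->
  cauchy rho b = cauchy mu (rcauchy nu b).
Proof.
case=> P [x [y [[sx sy xmu ynu] [ind xyrho]]]] hb.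
have sxy : selfadjoint (x + y) by exact: selfadjointD.
have hF := rcauchy_upper_half sy ynu hb; have FU := upper_half_unit hF.
have bU := upper_half_unit hb.
set F := rcauchy nu b in hF FU *; set g := cauchy nu b.
have gF : g * F = 1 by rewrite divrr // (cauchy_unit sy ynu hb).
rewrite (cauchyE sxy xyrho hb) (cauchyE sx xmu hF).
have yU := resolvent_unit sy hb; have xyU := resolvent_unit sxy hb.
have FxU := resolvent_unit sx hF.
set r := (_ - (x + y))^-1; set s := (_ - x)^-1; pose t := (ovps_inj P b - y)^-1.
have rE : r = t * (1 + x * r).
  have xyC : x + y = y + x by exact: addrC.
  by rewrite /r /t xyC; apply: resolvent_add => //; rewrite -xyC.
have [p hp] := resolvent_seq sy hb; have [q hq] := resolvent_seq sxy hb.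
have [k hk] := resolvent_seq sx hF.
pose bi := ovps_inj P b^-1.
(* Approximants, within [gen_alg y], of $t - b^{-1}$. *)
pose c n := bi * (y * nceval (ovps_inj P) y (p n)).
have hc : norm_cvg \oo c (bi * (y * t)).
  by apply: norm_cvgM; [exact: norm_cvg_cst|apply: norm_cvgM hp; exact: norm_cvg_cst].
have tE : t = bi + bi * (y * t) by exact: resolvent_expand.
have gE : g = b^-1 + ovps_E P (bi * (y * t)).
  by rewrite /g (cauchyE sy ynu hb) -/t {1}tE linearD ovps_Einj.
pose v n := 1 + x * nceval (ovps_inj P) (x + y) (q n).
have hv : norm_cvg \oo v (1 + x * r).
  apply: norm_cvgD; first exact: norm_cvg_cst.
  by apply: norm_cvgM hq; exact: norm_cvg_cst.
(* conditioning on the algebra of x replaces the resolvent of y by g *)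
have step a : a = 1 \/ gen_alg x a ->
    ovps_E P (a * r) = ovps_E P (a * ovps_inj P g * (1 + x * r)).
  move=> ha; rewrite {1}rE mulrA {1}tE gE rmorphD !(mulrDr a) !(mulrDl _ _ (1 + x * r)).
  rewrite !linearD; congr (_ + _).
  have h1 : norm_cvg \oo (fun n => ovps_E P (a * c n * v n))
      (ovps_E P (a * (bi * (y * t)) * (1 + x * r))).
    apply: norm_cvg_E; apply: norm_cvgM hv; apply: norm_cvgM hc; exact: norm_cvg_cst.
  have h2 : norm_cvg \oo (fun n => ovps_E P (a * ovps_inj P (ovps_E P (c n)) * v n))
      (ovps_E P (a * ovps_inj P (ovps_E P (bi * (y * t))) * (1 + x * r))).
    apply: norm_cvg_E; apply: norm_cvgM hv; apply: norm_cvgM; first exact: norm_cvg_cst.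
    apply: (@norm_cvg_lip _ _ _ _ _ _ 1 (ovps_inj P)) (norm_cvg_E hc) => u w.
    by rewrite mul1r -rmorphB; exact: inj_cnorm.
  apply: norm_cvg_unique h1 _; apply: norm_cvg_near h2.
  near=> n; apply/esym/monotone_mul => //.
  by apply: gen_alg_left; apply: gen_alg_mul_eval; exact: gen_alg_gen.
pose gi := ovps_inj P g; pose Fi := ovps_inj P F.
pose a n := gi * (x * nceval (ovps_inj P) x (k n)) * Fi.
have ha : norm_cvg \oo a (gi * (x * s) * Fi).
  apply: norm_cvgM; last exact: norm_cvg_cst.
  by apply: norm_cvgM; [exact: norm_cvg_cst|apply: norm_cvgM hk; exact: norm_cvg_cst].
have sE : s = gi + gi * (x * s).
  by have := resolvent_expand FU FxU; rewrite invrK.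
(* $sF - 1$ is a limit of elements of [gen_alg x], so [step] extends to $a = sF$ by linearity and
   continuity. *)
have saF : s * Fi = 1 + gi * (x * s) * Fi.
  by rewrite {1}sE mulrDl /gi /Fi -[in X in X + _]rmorphM gF rmorph1.
have key : ovps_E P (s * Fi * r) = ovps_E P (s * Fi * gi * (1 + x * r)).
  have h0 := step 1 (or_introl erefl); rewrite !mul1r in h0.
  rewrite saF !mulrDl !mul1r !linearD h0; congr (_ + _).
  have h1 : norm_cvg \oo (fun n => ovps_E P (a n * r)) (ovps_E P (gi * (x * s) * Fi * r)).
    by apply: norm_cvg_E; apply: norm_cvgM ha _; exact: norm_cvg_cst.
  have h2 : norm_cvg \oo (fun n => ovps_E P (a n * gi * (1 + x * r)))
      (ovps_E P (gi * (x * s) * Fi * gi * (1 + x * r))).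
    apply: norm_cvg_E; apply: norm_cvgM; last exact: norm_cvg_cst.
    by apply: norm_cvgM ha _; exact: norm_cvg_cst.
  apply: norm_cvg_unique h1 _; apply: norm_cvg_near h2.
  near=> n; apply/esym/step; right.
  apply: gen_alg_right; apply: gen_alg_left; apply: gen_alg_mul_eval; exact: gen_alg_gen.
have Fg : Fi * gi = 1 by rewrite -rmorphM mulVr ?rmorph1 // (cauchy_unit sy ynu hb).
(* As $Fg = 1$, [key] reads $E(sFr) = E(s) + E(sxr)$, so $E(s) = E(s(F - x)r) = E(r)$. *)
move: key; rewrite -(mulrA s Fi gi) Fg mulr1 mulrDr mulr1 linearD => /eqP.
by rewrite -subr_eq -linearB -(mulrA s) -mulrBr -mulrBl mulKr // => /eqP.
Unshelve. all: by end_near. Qed.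

End Convolution.

(** * Differentiation along paths *)

Section Increments.
Variable R : realType.

#[local] Instance increments_filter (t : R) : Filter (increments t).
Proof. exact: within_filter. Qed.

(** Small steps stay in $[0,1]$ when taken to the right from the left half and to the left from the
    right half. *)
Lemma increments_proper (t : R) : in01 t -> ProperFilter (increments t).
Proof.
move=> /andP[t0 t1]; apply: Build_ProperFilter_ex => A.
rewrite /increments /within /= => /nbhs_ballP[e /= e0 eA].
pose d := Num.min (e / 2) 2^-1; have d0 : 0 < d by rewrite lt_min; apply/andP; split; lra.
have de : d < e.
  by rewrite /d gt_min; apply/orP; left; lra.
have d12 : d <= 2^-1 by rewrite /d ge_min lexx orbT.
have [t2|t2] := leP t 2^-1.
  exists d; apply: eA; rewrite ?gt_eqF //=.
    by rewrite /ball /= sub0r normrN gtr0_norm.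
  by rewrite /in01; apply/andP; split; lra.
exists (- d); apply: eA; rewrite ?lt_eqF ?oppr_lt0 //=.
  by rewrite /ball /= sub0r opprK gtr0_norm.
by rewrite /in01; apply/andP; split; lra.
Qed.

Lemma increments_in01 (t : R) : \forall h \near increments t, in01 (t + h).
Proof. exact: withinT. Qed.

Lemma increments_neq0 (t : R) : \forall h \near increments t, h != 0.
Proof.
by apply: filterS (nbhs_dnbhs_neq (0 : R)) => h hn _.
Qed.

Lemma increments_cvg0 (t : R) : h @[h --> increments t] --> (0 : R).
Proof.
apply/cvgr0Pnorm_lt => e e0; apply: filterS (dnbhs0_lt (V := R^o) e0) => h he _.
exact: he.
Qed.

End Increments.
#[local] Existing Instance increments_filter.

(** * Calculus of difference quotients *)

Section DifferenceQuotient.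
Variables (R : realType) (B : cstarAlgType R) (t : R).
Implicit Types (u v : R -> B) (l m : B).

(** Stated for arbitrary [u] to obtain rules for sums and inverses; for [u s = cauchy (mu s) b] it
    unfolds to [diff_quotient mu t b]. *)
Definition quotient u (h : R) : B := (h^-1)%:C *: (u (t + h) - u t).

Lemma quotient_eq u v : u t = v t -> (forall s, in01 s -> u s = v s) ->
  \forall h \near increments t, quotient u h = quotient v h.
Proof.
by move=> uvt uv; apply: filterS (increments_in01 t) => h ht; rewrite /quotient uvt uv.
Qed.

Lemma quotientK u h : h != 0 -> u (t + h) = u t + h%:C *: quotient u h.
Proof.
by move=> h0; rewrite /quotient scalerA -rmorphM mulfV // scale1r [RHS]addrC subrK.
Qed.

Lemma quotient_continuous u l : norm_cvg (increments t) (quotient u) l ->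
  norm_cvg (increments t) (fun h => u (t + h)) (u t).
Proof.
move=> ul; apply: (norm_cvg_dom (g := fun h => (cnorm l + 1) * `|h|)); last first.
  have -> : nbhs (0 : R) = nbhs ((cnorm l + 1) * `|0 : R|) by rewrite normr0 mulr0.
  apply: cvgMr; apply: cvg_norm; exact: increments_cvg0.
apply: filterS2 (norm_cvg_bounded ul) (increments_neq0 t) => h hl h0.
rewrite quotientK // addrAC subrr add0r cnormZr mulrC.
by apply: ler_wpM2r.
Qed.

Lemma quotientD u v l m : norm_cvg (increments t) (quotient u) l ->
  norm_cvg (increments t) (quotient v) m ->
  norm_cvg (increments t) (quotient (fun s => u s + v s)) (l + m).
Proof.
move=> ul vm; apply: norm_cvg_near (norm_cvgD ul vm); near=> h.
by rewrite /quotient -scalerDr opprD addrACA.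
Unshelve. all: by end_near. Qed.

Lemma quotientBr u b l : norm_cvg (increments t) (quotient u) l ->
  norm_cvg (increments t) (quotient (fun s => u s - b)) l.
Proof.
move=> ul; apply: norm_cvg_near ul; near=> h.
by rewrite /quotient [- b]lock opprD addrACA subrr addr0.
Unshelve. all: by end_near. Qed.

(** The quotient of the inverse is $-u(t+h)^{-1} q(h) u(t)^{-1}$, with $q$ that of [u]; its first
    factor converges by continuity of [u] and of inversion. *)
Lemma quotientV u l : in01 t -> (forall s, in01 s -> u s \is a GRing.unit) ->
  norm_cvg (increments t) (quotient u) l ->
  norm_cvg (increments t) (quotient (fun s => (u s)^-1)) (- ((u t)^-1 * l * (u t)^-1)).
Proof.
move=> ht uU ul; have utU := uU t ht.
have uVc : norm_cvg (increments t) (fun h => (u (t + h))^-1) (u t)^-1.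
  apply: norm_cvgV => //; last exact: quotient_continuous ul.
  by apply: filterS (increments_in01 t) => h /uU.
apply: norm_cvg_near (norm_cvgN (norm_cvgM (norm_cvgM uVc ul) (norm_cvg_cst (u t)^-1))).
apply: filterS (increments_in01 t) => h /uU uhU.
rewrite /quotient -scalerAr -scalerAl -scalerN; congr (_ *: _).
by rewrite mulrBr mulrBl mulVr // mul1r -mulrA divrr // mulr1 opprB.
Qed.

End DifferenceQuotient.

Section Paths.
Variables (R : realType) (B : cstarAlgType R).
Implicit Types (mu nu rho : R -> sigma0 B).

(** Brings differentiability at $n = 1$ back to [cnorm]. The vector 1 realizes the value, and the
    supremum is over a bounded set. *)
Lemma cnorm_le_mxcnorm (M : 'M[B]_1) : cnorm (M ord0 ord0) <= mxcnorm M.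
Proof.
have cn (v : 'cV[B]_1) :
    Num.sqrt (cnorm ((mxstar v *m v) ord0 ord0)) = cnorm (v ord0 ord0).
  by rewrite !mxE big_ord1 !mxE cnorm_starM sqrtr_sqr ger0_norm ?cnorm_ge0.
rewrite /mxcnorm; apply: ub_le_sup.
  exists (cnorm (M ord0 ord0)) => _ [v /= v1 <-]; rewrite cn in v1; rewrite cn.
  rewrite mxE big_ord1; apply: le_trans (cnormM_le _ _) _.
  by rewrite ler_piMr // cnorm_ge0.
exists 1%:M; first by rewrite /= cn !mxE cnorm1.
by rewrite cn mulmx1.
Qed.

Lemma dcauchyP mu t b : differentiable_path mu -> in01 t -> upper_half b ->
  norm_cvg (increments t) (diff_quotient mu t b) (dcauchy mu t b).
Proof.
move=> dmu ht hb; have [Y /(_ _ hb) hY] := dmu 1 t ht.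
have hl : norm_cvg (increments t) (diff_quotient mu t b) (Y b%:M ord0 ord0).
  apply: norm_cvg_dom hY; near=> h.
  by apply: le_trans (cnorm_le_mxcnorm _); rewrite !mxE.
have FP := increments_proper ht.
by rewrite /dcauchy (norm_lim_eq hl).
Unshelve. all: by end_near. Qed.

End Paths.

(** * Boolean derivative, and a Taylor expansion uniform in the law *)

Section Derivatives.
Variables (R : realType) (B : cstarAlgType R).
Implicit Types (mu nu rho : R -> sigma0 B) (m : sigma0 B) (a b d w : B) (e t : R).

(** [sigma0] is defined without a realization; the convolution relations supply one, in which
    [cauchy] can be computed. *)
Definition realized m := exists (P : ovps B) (x : P), selfadjoint x /\ has_law x m.

Lemma cauchy_realized_unit m b : realized m -> upper_half b -> cauchy m b \is a GRing.unit.
Proof. by case=> P [x [sx xm]]; exact: cauchy_unit sx xm. Qed.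

Lemma rcauchy_realized_upper_half m b : realized m -> upper_half b -> upper_half (rcauchy m b).
Proof. by case=> P [x [sx xm]]; exact: rcauchy_upper_half sx xm. Qed.

Lemma boolean_conv_realized m n r : boolean_conv m n r -> [/\ realized m, realized n & realized r].
Proof.
case=> P [x [y [[sx sy xm yn] [_ xyr]]]].
by split; [exists P, x|exists P, y|exists P, (x + y); split => //; exact: selfadjointD].
Qed.

Lemma monotone_conv_realized m n r : monotone_conv m n r -> realized m /\ realized n.
Proof. by case=> P [x [y [[sx sy xm yn] _]]]; split; [exists P, x|exists P, y]. Qed.

Lemma quotient_rcauchy mu t b : differentiable_path mu ->
  (forall s, in01 s -> realized (mu s)) -> in01 t -> upper_half b ->
  norm_cvg (increments t) (quotient t (fun s => rcauchy (mu s) b))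
    (- (rcauchy (mu t) b * dcauchy mu t b * rcauchy (mu t) b)).
Proof.
move=> dmu rmu ht hb.
have uU s : in01 s -> cauchy (mu s) b \is a GRing.unit.
  by move=> /rmu rs; exact: cauchy_realized_unit.
exact: quotientV ht uU (dcauchyP dmu ht hb).
Qed.

Lemma boolean_derivative mu nu rho t b :
  differentiable_path mu -> differentiable_path nu ->
  (forall s, in01 s -> boolean_conv (mu s) (nu s) (rho s)) ->
  in01 t -> upper_half b ->
  let f := rcauchy (mu t) b in let g := rcauchy (nu t) b in
  has_dcauchy rho t b
    ((f + g - b)^-1 * (f * dcauchy mu t b * f + g * dcauchy nu t b * g) * (f + g - b)^-1).
Proof.
move=> dmu dnu conv ht hb f g; rewrite /has_dcauchy.
pose u s := rcauchy (mu s) b + rcauchy (nu s) b - b.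
have rmu s : in01 s -> realized (mu s) by case/conv/boolean_conv_realized.
have rnu s : in01 s -> realized (nu s) by case/conv/boolean_conv_realized.
have uU s : in01 s -> u s \is a GRing.unit.
  move=> hs; have [_ _ rrho] := boolean_conv_realized (conv s hs).
  have [uE _] := boolean_rcauchy (conv s hs) hb.
  by rewrite /u -uE unitrV; exact: cauchy_realized_unit.
have uE s : in01 s -> cauchy (rho s) b = (u s)^-1.
  by move=> hs; have [_] := boolean_rcauchy (conv s hs) hb.
have q1 := quotient_rcauchy dmu rmu ht hb; have q2 := quotient_rcauchy dnu rnu ht hb.
have q : norm_cvg (increments t) (quotient t u)
    (- (f * dcauchy mu t b * f) - g * dcauchy nu t b * g).
  by apply: quotientBr; exact: quotientD q1 q2.
have qE : \forall h \near increments t,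
    quotient t (fun s => (u s)^-1) h = diff_quotient (rho) t b h.
  apply: (@quotient_eq _ _ t (fun s => (u s)^-1) (fun s => cauchy (rho s) b)).
    by rewrite uE.
  by move=> s hs; rewrite uE.
apply: norm_cvg_near qE _.
(* The signs from the two uses of the inverse rule cancel. *)
have -> : (f + g - b)^-1 * (f * dcauchy mu t b * f + g * dcauchy nu t b * g) *
    (f + g - b)^-1 = - ((u t)^-1 *
    (- (f * dcauchy mu t b * f) - g * dcauchy nu t b * g) * (u t)^-1).
  by rewrite -opprD mulrN mulNr opprK.
exact: quotientV ht uU q.
Qed.

(** The imaginary part moves by at most [e / 2]. This fixes the radius of the Taylor expansion. *)
Lemma above_add e a d : 0 < e -> above e a -> cnorm d <= e / 2 -> above (e / 2) (a + d).
Proof.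
move=> e0 ea de; rewrite /above impartD.
have hd : cnorm (- impart d) <= e / 2.
  apply: le_trans de; rewrite cnormN /impart cnormZ Normc.normcV Normc.normcM normc_i mulr1.
  rewrite -[2]/(2%:R) -(rmorph_nat (real_complex R)) normc_real ger0_norm // ler_pdivrMl //.
  by apply: le_trans (cnormB_le _ _) _; rewrite cnorm_star mulr_natl mulr2n.
have sd : selfadjoint (- impart d).
  by rewrite /selfadjoint starN selfadjoint_impart.
have -> : impart a + impart d - (e / 2)%:C%:A =
    (impart a - e%:C%:A) + ((e / 2)%:C%:A - - impart d).
  have -> : e%:C%:A = (e / 2)%:C%:A + (e / 2)%:C%:A :> B.
    by rewrite -scalarD -splitr.
  by rewrite opprK opprD !addrA subrK addrAC.
by apply: posD => //; exact: cnorm_le_pos.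
Qed.

Section Realized.
Variables (P : ovps B) (x : P) (m : sigma0 B) (e : R) (a : B).
Hypotheses (sx : selfadjoint x) (xm : has_law x m) (e0 : 0 < e) (ea : above e a).
Local Notation inj := (ovps_inj P).
Local Notation E := (ovps_E P).
Local Notation r := (inj a - x)^-1.

Lemma cnorm_resolvent_le : cnorm r <= 2 / e.
Proof. by have [] := above_unit e0 (above_inj_sub sx ea). Qed.

Lemma cnorm_E_prod3 (u v : P) w (c c' : R) : cnorm u <= c -> cnorm v <= c' ->
  cnorm (E (u * inj w * v)) <= 6 * (c * cnorm w * c').
Proof.
move=> uc vc; have [[u0 v0] w0] := (cnorm_ge0 u, cnorm_ge0 v, cnorm_ge0 w).
apply: le_trans (E_cnorm _) _; rewrite ler_pM2l //.
apply: le_trans (cnormM_le _ _) _; apply: ler_pM; rewrite ?cnorm_ge0 //.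
apply: le_trans (cnormM_le _ _) _; apply: ler_pM; rewrite ?cnorm_ge0 //.
exact: inj_cnorm.
Qed.

(** With $s$ the resolvent at $a + d$, the resolvent identity used twice gives $s - r + rdr =
    sdrdr$. The constant is $6 (4/e)(2/e)(2/e)$, whatever the law and the realization. *)
Lemma cauchy_taylor_realized d : cnorm d <= e / 2 ->
  cnorm (cauchy m (a + d) - cauchy m a - - E (r * inj d * r)) <=
  96 / e ^+ 3 * cnorm d ^+ 2.
Proof.
move=> de; have ead := above_add e0 ea de.
have e20 : 0 < e / 2 by rewrite divr_gt0.
have ha := above_upper_half e0 ea; have had := above_upper_half e20 ead.
rewrite (cauchyE sx xm ha) (cauchyE sx xm had) opprK.
have sU := resolvent_unit sx had; have rU := resolvent_unit sx ha.
set s := (inj (a + d) - x)^-1.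
have sr : s - r = - (s * inj d * r).
  have -> : s - r = s * ((inj a - x) - (inj (a + d) - x)) * r.
    by rewrite mulrBr mulrBl mulVr // mul1r -mulrA divrr // mulr1.
  by rewrite rmorphD [inj a + _ - x]addrAC opprD addrA subrr sub0r mulrN mulNr.
have -> : E s - E r + E (r * inj d * r) = E (s * inj d * r * inj d * r).
  have sr' : s * inj d * r = r - s by rewrite -[RHS]opprB sr opprK.
  by rewrite -linearB -linearD sr' !mulrBl sr' opprB addrC.
have e1 : 0 < 2 / e by rewrite divr_gt0.
have se : cnorm s <= 4 / e.
  have [_] := above_unit e20 (above_inj_sub sx ead); rewrite -/s.
  by rewrite (_ : 2 / (e / 2) = 4 / e) //; field; rewrite gt_eqF.
have re := cnorm_resolvent_le.
have srd : cnorm (s * inj d * r) <= 4 / e * cnorm d * (2 / e).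
  apply: le_trans (cnormM_le _ _) _; apply: ler_pM; rewrite ?cnorm_ge0 //.
  apply: le_trans (cnormM_le _ _) _; apply: ler_pM; rewrite ?cnorm_ge0 //.
  exact: inj_cnorm.
apply: le_trans (cnorm_E_prod3 d srd re) _.
by rewrite le_eqVlt; apply/orP; left; apply/eqP; field; rewrite gt_eqF.
Qed.

Lemma dnbhs_normc_lt (c : R) : 0 < c ->
  \forall z \near (0 : R[i]^o)^', Normc.normc (z : R[i]) < c.
Proof.
move=> c0; have c0' : 0 < c%:C by rewrite ltcR.
by apply: filterS (dnbhs0_lt (V := R[i]^o) c0') => z; rewrite normc_def ltcR; case: z.
Qed.

Lemma derivative_realized w : derivative (cauchy m) a w = - E (r * inj w * r).
Proof.
rewrite /derivative; apply: norm_lim_eq.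
pose C := 96 / e ^+ 3 * cnorm w ^+ 2.
apply: (norm_cvg_dom (g := fun z : R[i] => C * Normc.normc z)).
  have w0 := cnorm_ge0 w.
  (* Below this radius [z *: w] is an admissible increment; the added 1 covers [w = 0]. *)
  have w1 : 0 < e / 2 / (cnorm w + 1) by rewrite !divr_gt0 // ltr_wpDl.
  apply: filterS2 (dnbhs_normc_lt w1) (nbhs_dnbhs_neq (0 : R[i]^o)) => z zw z0.
  have nz0 : 0 < Normc.normc z.
    by have := z0; rewrite -normr_gt0 normc_def ltcR; case: (z).
  have zwe : cnorm (z *: w) <= e / 2.
    rewrite cnormZ; rewrite ltr_pdivlMr ?ltr_wpDl // in zw.
    by apply: le_trans (ltW zw); rewrite ler_pM2l // lerDl.
  have := cauchy_taylor_realized zwe.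
  have -> : E (r * inj (z *: w) * r) = z *: E (r * inj w * r).
    by rewrite linearZ -scalerAr -scalerAl linearZ.
  set G := _ - cauchy m a => tay.
  have -> : z^-1 *: G - - E (r * inj w * r) = z^-1 *: (G - - (z *: E (r * inj w * r))).
    by rewrite !opprK [RHS]scalerDr scalerA mulVf // scale1r.
  rewrite cnormZ Normc.normcV ler_pdivrMl //; apply: le_trans tay _.
  by rewrite cnormZ /C le_eqVlt; apply/orP; left; apply/eqP; ring.
apply/cvgr0Pnorm_lt => c c0.
have C0 : 0 <= C by rewrite mulr_ge0 ?sqr_ge0 // divr_ge0 ?exprn_ge0 // ltW.
have c1 : 0 < c / (C + 1) by rewrite divr_gt0 // ltr_wpDl.
apply: filterS (dnbhs_normc_lt c1) => z; rewrite ltr_pdivlMr ?ltr_wpDl // => zc.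
have z0 : 0 <= Normc.normc z by case: (z) => ? ?; exact: sqrtr_ge0.
rewrite ger0_norm; last exact: mulr_ge0 C0 z0.
apply: le_lt_trans zc.
by rewrite mulrC ler_wpM2l // lerDl.
Qed.

End Realized.

Lemma cauchy_taylor m e a d : realized m -> 0 < e -> above e a -> cnorm d <= e / 2 ->
  cnorm (cauchy m (a + d) - cauchy m a - derivative (cauchy m) a d) <=
  96 / e ^+ 3 * cnorm d ^+ 2.
Proof.
case=> P [x [sx xm]] e0 ea de; rewrite (derivative_realized sx xm e0 ea).
exact: cauchy_taylor_realized.
Qed.

(** The constant is $6 (2/e)^2$, again uniform in the law. *)
Lemma derivative_cauchy_lip m e a d w : realized m -> 0 < e -> above e a ->
  cnorm (derivative (cauchy m) a d - derivative (cauchy m) a w) <=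
  24 / e ^+ 2 * cnorm (d - w).
Proof.
case=> P [x [sx xm]] e0 ea; rewrite !(derivative_realized sx xm e0 ea).
rewrite opprK addrC -linearB -mulrBl -mulrBr -rmorphB.
have re := cnorm_resolvent_le sx e0 ea.
apply: le_trans (cnorm_E_prod3 _ re re) _; rewrite cnormBC.
by rewrite le_eqVlt; apply/orP; left; apply/eqP; field; rewrite gt_eqF.
Qed.

Lemma derivative_cauchyZ m e a (z : R[i]) w : realized m -> 0 < e -> above e a ->
  derivative (cauchy m) a (z *: w) = z *: derivative (cauchy m) a w.
Proof.
case=> P [x [sx xm]] e0 ea; rewrite !(derivative_realized sx xm e0 ea).
by rewrite linearZ -scalerAr -scalerAl linearZ scalerN.
Qed.

End Derivatives.

(** * Derivative of the monotone convolution *)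

Section MonotoneDerivative.
Variables (R : realType) (B : cstarAlgType R).
Implicit Types (mu nu rho : R -> sigma0 B) (a b w : B) (e t : R).

(* [derivative (cauchy m) a w] is a difference quotient of [cauchy m] up to an
   error that is uniform in the law [m]. *)
Lemma derivative_path_cvg mu t e a w : differentiable_path mu ->
  (forall s, in01 s -> realized (mu s)) -> in01 t -> 0 < e -> above e a ->
  norm_cvg (increments t) (fun h => derivative (cauchy (mu (t + h))) a w)
    (derivative (cauchy (mu t)) a w).
Proof.
move=> dmu rmu ht e0 ea; apply/norm_cvgP => c c0.
pose C := 96 / e ^+ 3 * cnorm w ^+ 2.
have w0 := cnorm_ge0 w.
have C0 : 0 <= C by rewrite mulr_ge0 ?sqr_ge0 // divr_ge0 ?exprn_ge0 // ltW.
(* The first bound keeps the increment within the Taylor radius; the second makes the remainders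
   small compared with $zc$. *)
pose z := Num.min (e / 2 / (cnorm w + 1)) (c / (8 * (C + 1))).
have z0 : 0 < z by rewrite lt_min !divr_gt0 ?mulr_gt0 // ltr_wpDl.
have zw : cnorm (z%:C *: w) <= e / 2.
  rewrite cnormZr gtr0_norm //; apply: le_trans (_ : z * (cnorm w + 1) <= _).
    by rewrite ler_pM2l // lerDl.
  by rewrite -ler_pdivlMr ?ltr_wpDl // /z ge_min lexx.
have zC : 2 * (C * z) <= c / 4.
  have : z <= c / (8 * (C + 1)) by rewrite /z ge_min lexx orbT.
  rewrite ler_pdivlMr ?mulr_gt0 ?ltr_wpDl //; nra.
have e20 : 0 < e / 2 by rewrite divr_gt0.
have ha := above_upper_half e0 ea.
have hd := above_upper_half e20 (above_add e0 ea zw).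
pose D s := cauchy (mu s) (a + z%:C *: w) - cauchy (mu s) a.
have taylor s : in01 s ->
    cnorm (D s - z%:C *: derivative (cauchy (mu s)) a w) <= C * z ^+ 2.
  move=> hs; have := cauchy_taylor (rmu s hs) e0 ea zw.
  rewrite (derivative_cauchyZ _ _ (rmu s hs) e0 ea) => /le_trans; apply.
  by rewrite cnormZr gtr0_norm // /C le_eqVlt; apply/orP; left; apply/eqP; ring.
have Dc : norm_cvg (increments t) (fun h => D (t + h)) (D t).
  have cont b : upper_half b ->
      norm_cvg (increments t) (fun h => cauchy (mu (t + h)) b) (cauchy (mu t) b).
    move=> hb; exact: (@quotient_continuous _ _ t (fun s => cauchy (mu s) b) _
      (dcauchyP dmu ht hb)).
  by have FF := increments_filter t; apply: norm_cvgB; exact: cont.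
have zc : 0 < z * (c / 2) by rewrite mulr_gt0 // divr_gt0.
have /norm_cvgP/(_ _ zc) near_D := Dc.
apply: filterS2 near_D (increments_in01 t) => h hD hs.
have tay_s := taylor _ hs; have tay_t := taylor _ ht.
(* After multiplication by $z$, the remainders at $t+h$ and $t$ contribute at most $zc/4$ together,
   and [D] moves by less than $zc/2$. *)
rewrite -(ltr_pM2l z0) -[z in ltLHS]gtr0_norm // -cnormZr scalerBr.
apply: le_lt_trans (cnorm_dist _ (D (t + h)) _) _; rewrite cnormBC.
apply: le_lt_trans (lerD (lexx _) (cnorm_dist _ (D t) _)) _.
have : C * z ^+ 2 * 2 <= z * (c / 4) by rewrite expr2; nra.
lra.
Qed.

(** The increment splits into a move of the point $F_\nu(b)$ under the law $\mu(t+h)$ and a move of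
    the law at the fixed point $g$. In the first part the law varies too, hence the need for a
    uniform Taylor expansion. *)
Lemma monotone_derivative mu nu rho t b :
  differentiable_path mu -> differentiable_path nu ->
  (forall s, in01 s -> monotone_conv (mu s) (nu s) (rho s)) ->
  in01 t -> upper_half b ->
  let g := rcauchy (nu t) b in
  has_dcauchy rho t b
    (derivative (cauchy (mu t)) g (- (g * dcauchy nu t b * g)) + dcauchy mu t g).
Proof.
move=> dmu dnu conv ht hb g; rewrite /has_dcauchy.
have rmu s : in01 s -> realized (mu s) by case/conv/monotone_conv_realized.
have rnu s : in01 s -> realized (nu s) by case/conv/monotone_conv_realized.
have hg : upper_half g by exact: rcauchy_realized_upper_half (rnu t ht) hb.
have [e e0 eg] := upper_half_above hg.
set w := - _; pose F s := rcauchy (nu s) b; pose q := quotient t F.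
have qw : norm_cvg (increments t) q w by exact: quotient_rcauchy.
pose L s := derivative (cauchy (mu s)) g.
pose u h := (h^-1)%:C *: (cauchy (mu (t + h)) (F (t + h)) - cauchy (mu (t + h)) g).
have uL : norm_cvg (increments t) u (L t w).
  have Lw : norm_cvg (increments t) (fun h => L (t + h) w) (L t w).
    exact: derivative_path_cvg dmu rmu ht e0 eg.
  (* For small [h] one has $\|q(h)\| \le \|w\| + 1$. *)
  pose K := 96 / e ^+ 3 * (cnorm w + 1) ^+ 2.
  have K0 : 0 <= K by rewrite mulr_ge0 ?sqr_ge0 // divr_ge0 ?exprn_ge0 // ltW.
  (* The terms bound the Taylor remainder, the replacement of $q(h)$ by $w$, and that of the law at
     $t+h$ by the law at $t$. *)
  apply: (norm_cvg_dom (g := fun h => K * `|h| +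
    24 / e ^+ 2 * cnorm (q h - w) + cnorm (L (t + h) w - L t w))); last first.
    have -> : nbhs (0 : R) = nbhs (K * `|0 : R| + 24 / e ^+ 2 * 0 + 0).
      by rewrite normr0 !mulr0 !addr0.
    apply: cvgD Lw; apply: cvgD; last exact: cvgMr.
    by apply: cvgMr; apply: cvg_norm; exact: increments_cvg0.
  have e20 : 0 < e / 2 by rewrite divr_gt0.
  have /norm_cvgP/(_ _ e20) near_F := quotient_continuous qw.
  apply: filterS2 (filterI near_F (norm_cvg_bounded qw))
    (filterI (increments_in01 t) (increments_neq0 t)) => h [Fh qh] [hs h0].
  have FE : F (t + h) = g + h%:C *: q h by exact: quotientK.
  have dE : F (t + h) - F t = h%:C *: q h by rewrite FE addrAC subrr add0r.
  have de : cnorm (h%:C *: q h) <= e / 2 by rewrite -dE ltW.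
  have rs := rmu _ hs.
  rewrite -(subrKA (L (t + h) w)).
  apply: le_trans (cnormD_le _ _) _; rewrite lerD2r -(subrKA (L (t + h) (q h))).
  apply: le_trans (cnormD_le _ _) _; apply: lerD; last first.
    exact: derivative_cauchy_lip rs e0 eg.
  have := cauchy_taylor rs e0 eg de; rewrite -FE (derivative_cauchyZ _ _ rs e0 eg).
  set G := _ - cauchy _ g => tay.
  have -> : u h - L (t + h) (q h) = (h^-1)%:C *: (G - h%:C *: L (t + h) (q h)).
    by rewrite [RHS]scalerBr scalerA -rmorphM mulVf // scale1r.
  have nh0 : 0 < `|h| by rewrite normr_gt0.
  rewrite cnormZr normfV ler_pdivrMl //; apply: le_trans tay _.
  rewrite cnormZr exprMn /K.
  have -> : `|h| * (96 / e ^+ 3 * (cnorm w + 1) ^+ 2 * `|h|) =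
    96 / e ^+ 3 * (`|h| ^+ 2 * (cnorm w + 1) ^+ 2) by ring.
  apply: ler_wpM2l; first by rewrite divr_ge0 ?exprn_ge0 // ltW.
  apply: ler_wpM2l; first exact: sqr_ge0.
  by rewrite lerXn2r ?nnegrE ?addr_ge0 ?cnorm_ge0.
have hE s : in01 s -> cauchy (rho s) b = cauchy (mu s) (F s).
  by move=> hs; exact: monotone_cauchy (conv s hs) hb.
apply: norm_cvg_near (norm_cvgD uL (dcauchyP dmu ht hg)).
apply: filterS (increments_in01 t) => h hs.
by rewrite /u /diff_quotient -scalerDr subrKA !hE.
Qed.

End MonotoneDerivative.

(** Existence of the limit is asserted along with the value of [dcauchy], which takes a default
    value when there is no limit. *)
Theorem theorem7p2 (R : realType) (B : cstarAlgType R)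
    (mu nu : R -> sigma0 B) :
  differentiable_path mu -> differentiable_path nu ->
  (forall rho : R -> sigma0 B,
     (forall t, in01 t -> boolean_conv (mu t) (nu t) (rho t)) ->
     forall (t : R) (b : B), in01 t -> upper_half b ->
     let Fmu := rcauchy (mu t) b in
     let Fnu := rcauchy (nu t) b in
     let value :=
       (Fmu + Fnu - b)^-1 *
       (Fmu * dcauchy mu t b * Fmu + Fnu * dcauchy nu t b * Fnu) *
       (Fmu + Fnu - b)^-1 in
     has_dcauchy rho t b value /\ dcauchy rho t b = value) /\
  (forall rho : R -> sigma0 B,
     (forall t, in01 t -> monotone_conv (mu t) (nu t) (rho t)) ->
     forall (t : R) (b : B), in01 t -> upper_half b ->
     let Fnu := rcauchy (nu t) b in
     let value :=
       derivative (cauchy (mu t)) Fnu (- (Fnu * dcauchy nu t b * Fnu)) +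
       dcauchy mu t Fnu in
     has_dcauchy rho t b value /\ dcauchy rho t b = value).
Proof.
move=> dmu dnu; split=> rho conv t b ht hb.
  have h := boolean_derivative dmu dnu conv ht hb.
  by split=> //; have FP := increments_proper ht; exact: norm_lim_eq h.
have h := monotone_derivative dmu dnu conv ht hb.
by split=> //; have FP := increments_proper ht; exact: norm_lim_eq h.
Qed.
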